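(* Let $p>3$ be a prime. Then $$\sum_{k=0}^{p-1}\frac{k\binom{2k}k^3}{16^k}(H_{2k}-H_k)-\frac16\equiv\left(\frac{-1}p\right)\sum_{k=0}^{p-1}\frac{k\binom{2k}k^3}{256^k}(H_{2k}-H_k)-\frac16$$ $$\equiv\begin{cases}-2x^2(4q_p(2)+3)/9\pmod p&\text{if } p=x^2+3y^2\ (x,y\in\mathbb Z),\\0\pmod p&\text{if } p\equiv 2\pmod 3.\end{cases}$$
   Context: $H_k=\sum_{0<j\le k}\frac1j$ denotes the $k$-th harmonic number ($H_0=0$), and $q_p(2)=(2^{p-1}-1)/p$ is the Fermat quotient. $\left(\frac{\cdot}{p}\right)$ is the Legendre symbol. A congruence $s\equiv t\pmod p$ between rational numbers means $s-t\in p\,\mathbb Z_{(p)}$, where $\mathbb Z_{(p)}$ is the ring of rational numbers with denominator prime to $p$. Both congruences in the display are modulo $p$. *)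

(* Defs.v *)
From HB Require Import structures.
From mathcomp Require Import all_boot all_order all_algebra.

Set Implicit Arguments.
Unset Strict Implicit.
Unset Printing Implicit Defensive.

Import Order.TTheory GRing.Theory Num.Theory.

Local Open Scope ring_scope.

Definition harmonic_number (k : nat) : rat := \sum_(1 <= j < k.+1) j%:R^-1.

(* (2^(p-1) - 1) / p, with the division taken in rat *)
Definition fermat_quotient2 (p : nat) : rat := (2 ^+ p.-1 - 1) / p%:R.

(* The Legendre symbol (a / p), meaningful for p an odd prime. *)
Definition legendre (a : int) (p : nat) : int :=
  if (p%:Z %| a)%Z then 0
  else if [exists x : 'I_p, ((x : nat)%:Z ^+ 2 == a %[mod p%:Z])%Z] then 1
  else -1.

(* Z_(p); denq r is the positive denominator of r in lowest terms. *)
Definition Zlocal (p : nat) : pred rat := [pred r | coprimez p%:Z (denq r)].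

(* s - t lies in p Z_(p); neither s nor t is required to lie in Z_(p). *)
Definition eqmod_rat (p : nat) (s t : rat) : Prop :=
  exists2 u : rat, u \in Zlocal p & s - t = p%:R * u.

(* The sum for the base m; all arithmetic is in rat, as the terms with
   p <= 2k involve harmonic numbers with denominator divisible by p. *)
Definition harmonic_binomial_sum (p m : nat) : rat :=
  \sum_(0 <= k < p)
    (k%:R * 'C(2 * k, k)%:R ^+ 3 / m%:R ^+ k
     * (harmonic_number (2 * k)%N - harmonic_number k)).

(* Main.v *)
Require Import Defs.
From HB Require Import structures.
From mathcomp Require Import all_boot all_order all_algebra.
From mathcomp Require Import finfield algC ring zify.

(** Let p = 2n+1.  The terms with k > n vanish modulo p, and for k <= n one has
    C(2k,k) = (-4)^k C(n,k) modulo p, so both sums become sums of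
    k C(n,k)^3 z^k h_k over a field K of characteristic p, with
    h_k = H_2k - H_k and z = -4, -1/4; they are exchanged by k -> n - k.

    Put f = sum C(n,k)^2 X^k, g = sum 4 C(n,k)^2 h_k X^k,
    F = sum C(n,k)^3 (-4X)^k, G = sum C(n,k)^3 (-4X)^k h_k.  In characteristic p,
    f and f log X + g solve the hypergeometric equation of 2F1(1/2,1/2;1), which is
    invariant under X -> 1 - X, and F, G solve the analogous equations for 3F2.
    Polynomial solutions of degree < p are determined by their constant term, so
    Clausen's formula F(X - X^2) = f^2 holds, together with its logarithmic companion
    6 G(X - X^2) = f (g + g(1 - X) f(1)) + 2 H_n f^2.
    Evaluate at t with t^2 - t + 1 = 0, where X - X^2 = 1: since t is fixed by
    X -> 1/(1 - X), the symmetries X -> 1 - X and X -> 1/X of f and g, together with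
    the Wronskian of f and g, express G'(1) through F(1) = f(t)^2 and
    H_n = -2 q_p(2).

    If p = 2 mod 3, the symmetries force f(t) = 0.  If p = x^2 + 3y^2, then f(t) is
    up to sign the Hasse invariant of a curve with complex multiplication by the
    cube roots of unity; the norm of a Jacobi sum shows f(t)^2 = 4x^2. *)

Import Order.TTheory GRing.Theory Num.Theory.

Local Open Scope ring_scope.

(** * The hypergeometric operators *)

Section Euler.
Context (K : fieldType).
Implicit Types y f g Y : {poly K}.

Definition theta y : {poly K} := 'X * y^`().

Lemma coef_theta y k : (theta y)`_k = k%:R * y`_k.
Proof. by case: k => [|k]; rewrite coefXM ?mul0r //= coef_deriv mulr_natl. Qed.

Lemma coef_iter_theta m y k : (iter m theta y)`_k = k%:R ^+ m * y`_k.
Proof.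
by elim: m => [|m IH] /=; rewrite ?expr0 ?mul1r // coef_theta IH mulrA -exprS.
Qed.

(* The coefficients of y vanish recursively, k^m being invertible for 0 < k < p. *)
Lemma theta_uniq (p c m : nat) (a : nat -> {poly K}) (r : nat) y :
  p \in [pchar K] -> c%:R != 0 :> K ->
  c%:R * iter m theta y = 'X * \sum_(i < r) a i * iter i theta y ->
  y`_0 = 0 -> (size y <= p)%N -> y = 0.
Proof.
move=> chp c0 eqy y0 sy; apply/polyP => k; rewrite coef0.
have [k_lt|] := ltnP k p; last by move=> k_ge; rewrite nth_default // (leq_trans sy).
elim/ltn_ind: k k_lt => -[|k] IH k_lt //.
have /(congr1 (fun q : {poly K} => q`_k.+1)) := eqy.
rewrite mulr_natl coefMn coef_iter_theta coefXM /= coef_sum big1 => [/eqP|i _].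
  rewrite -[_ *+ c]mulr_natl !mulf_eq0 (negPf c0) expf_eq0 -(dvdn_pcharf chp) /=.
  by rewrite gtnNdvd // andbF => /eqP.
rewrite coefM big1 // => j _; rewrite coef_iter_theta IH ?mulr0 //.
  by rewrite ltnS leq_subr.
by rewrite (leq_ltn_trans (leq_subr _ _)) // ltnW.
Qed.

Let D : {poly K} := 'X - 'X^2.
Let s : {poly K} := 1 - 'X *+ 2.

(* 4 times the operator of 2F1(1/2,1/2;1;X); L3 is its symmetric square. *)
Definition L2 y : {poly K} := D * y^`()^`() *+ 4 + s * y^`() *+ 4 - y.

Definition L3 y : {poly K} :=
  D ^+ 2 * y^`()^`()^`() *+ 4 + D * s * y^`()^`() *+ 12
  + (s ^+ 2 - D *+ 3) * y^`() *+ 4 - s * y *+ 2.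

Lemma deriv_L2 y :
  (L2 y)^`() = D * y^`()^`()^`() *+ 4 + s * y^`()^`() *+ 8 - y^`() *+ 9.
Proof. by rewrite /L2 /D /s !derivE; ring. Qed.

(** Products of solutions of [L2] solve [L3]. The terms in [L2 f] and [L2 g] are kept because the
    formula is also applied to a factor that satisfies an inhomogeneous equation. *)
Lemma L3M f g :
  L3 (f * g) = D * f * (L2 g)^`() + s * f * L2 g + D * f^`() * L2 g *+ 3
             + (D * g * (L2 f)^`() + s * g * L2 f + D * g^`() * L2 f *+ 3).
Proof. by rewrite !deriv_L2 /L3 /L2 !derivE; ring. Qed.

(* 4 times the operator of 3F2(1/2,1/2,1/2;1,1;4X). *)
Definition M3 Y : {poly K} :=
  4 * 'X^2 * (1 - 4 * 'X) * Y^`()^`()^`() + 12 * 'X * (1 - 6 * 'X) * Y^`()^`()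
  + 4 * (1 - 13 * 'X) * Y^`() - 2 * Y.

(** The change of variable behind Clausen's formula: X - X^2 pulls the third-order equation back to
    the symmetric square, and the factor [s] is the derivative of [D]. *)
Lemma L3_comp Y : L3 (Y \Po D) = s * (M3 Y \Po D).
Proof.
rewrite /M3 comp_polyB !comp_polyD !comp_polyM !comp_polyB !comp_polyM !rmorph_nat.
rewrite rmorph1 comp_polyX.
rewrite /L3 !(deriv_comp, derivE) /D /s ?derivE.
ring.
Qed.

End Euler.

Arguments theta {K}.
Arguments L2 {K}.
Arguments L3 {K}.
Arguments M3 {K}.

Section Theta.
Context (K : fieldType).
Implicit Types y Y : {poly K}.

(* X N2 is a third of the derivative of theta^3 - 4X (theta + 1/2)^3 with respect to
   theta: the inhomogeneous term created by differentiating coefficients in k. *)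
Definition N2 Y : {poly K} :=
  'X * (1 - 4 * 'X) * Y^`()^`() + (1 - 8 * 'X) * Y^`() - Y.

Lemma thetaE2 y : theta (theta y) = 'X * y^`() + 'X^2 * y^`()^`().
Proof. by rewrite /theta !derivE; ring. Qed.

Lemma thetaE3 y : theta (theta (theta y)) =
  'X * y^`() + 3 * 'X^2 * y^`()^`() + 'X^3 * y^`()^`()^`().
Proof. by rewrite /theta !derivE; ring. Qed.

(** Written in [theta], an operator acts on coefficients by polynomials in k, so a differential
    equation becomes a recurrence; the factor X avoids negative powers. *)
Lemma L2_theta y : 'X * L2 y =
  theta (theta y) *+ 4 - 'X * (theta (theta y) *+ 4 + theta y *+ 4 + y).
Proof. by rewrite /L2 thetaE2 /theta; ring. Qed.

Lemma L3_theta y : 'X * L3 y =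
  4 * theta (theta (theta y))
  - 'X * ((2 - 4 * 'X) * y + (8 - 12 * 'X) * theta y
          + 12 * (1 - 'X) * theta (theta y)
          + (8 - 4 * 'X) * theta (theta (theta y))).
Proof. by rewrite /L3 thetaE3 thetaE2 /theta; ring. Qed.

Lemma M3_theta Y : 'X * M3 Y =
  theta (theta (theta Y)) *+ 4
  - 'X * (theta (theta (theta Y)) *+ 16 + theta (theta Y) *+ 24
          + theta Y *+ 12 + Y *+ 2).
Proof. by rewrite /M3 thetaE3 thetaE2 /theta; ring. Qed.

Lemma N2_theta Y : 'X * N2 Y =
  theta (theta Y) - 'X * (theta (theta Y) *+ 4 + theta Y *+ 4 + Y).
Proof. by rewrite /N2 thetaE2 /theta; ring. Qed.

Context (p : nat) (chp : p \in [pchar K]) (p_gt2 : (2 < p)%N).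

Lemma natf4_neq0 : 4 != 0 :> K.
Proof.
rewrite -(dvdn_pcharf chp) (Euclid_dvdX 2 2 (pcharf_prime chp)) andbT.
by rewrite gtnNdvd.
Qed.

Lemma L2_uniq y : L2 y = 0 -> y`_0 = 0 -> (size y <= p)%N -> y = 0.
Proof.
move=> L2y; apply: (@theta_uniq K p 4 2 (nth 0 [:: 1; 4; 4]) 3 y chp natf4_neq0).
apply/eqP; rewrite !big_ord_recr big_ord0 /= add0r -subr_eq0 -(mulr0 'X) -L2y.
by apply/eqP; rewrite L2_theta; ring.
Qed.

Lemma L3_uniq y : L3 y = 0 -> y`_0 = 0 -> (size y <= p)%N -> y = 0.
Proof.
move=> L3y.
apply: (@theta_uniq K p 4 3
  (nth 0 [:: 2 - 4 * 'X; 8 - 12 * 'X; 12 * (1 - 'X); 8 - 4 * 'X]) 4 y chp natf4_neq0).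
apply/eqP; rewrite !big_ord_recr big_ord0 /= add0r -subr_eq0 -(mulr0 'X) -L3y.
by apply/eqP; rewrite L3_theta; ring.
Qed.

End Theta.

Arguments N2 {K}.

(** * Recurrences and differential equations for f, g, F and G *)

Section Sequences.
Context (K : fieldType) (n : nat) (chp : n.*2.+1 \in [pchar K]) (n_gt0 : (0 < n)%N).

(* Only the values at k < p are residues of harmonic numbers: in K, 1/p = 0.  The
   later ones always occur multiplied by a vanishing binomial coefficient. *)
Definition harm k : K := \sum_(1 <= j < k.+1) j%:R^-1.
Definition harm_gap k : K := harm k.*2 - harm k.
Definition binF k : K := 'C(n, k)%:R.

(** In characteristic p = 2n + 1 the integer n plays the role of -1/2, which is how the
    hypergeometric parameters 1/2 arise. *)
Lemma half_pchar : n%:R *+ 2 = -1 :> K.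
Proof.
by apply/eqP; rewrite -addr_eq0 -mulrnA muln2 -[X in _ + X]/(1%:R) -natrD addn1 pcharf0.
Qed.

Lemma two_neq0 : 2 != 0 :> K.
Proof.
rewrite -(dvdn_pcharf chp) gtnNdvd // ltnS.
by have := n_gt0; rewrite -(leq_double 1).
Qed.

(** The term ratio of (-1)^k (1/2)_k / k!, cleared of denominators so that it holds for every k,
    including those with p dividing k + 1. *)
Lemma binFS k : binF k.+1 * (2 * k%:R + 2) = - (2 * k%:R + 1) * binF k.
Proof.
have [k_le|k_gt] := leqP k n; last by rewrite /binF !bin_small ?mul0r ?mulr0 // ltnW.
have := congr1 (fun m => m%:R : K) (mul_bin_left n k).
rewrite /binF !natrM natrB // -natr1 => E.
have -> : 'C(n, k.+1)%:R * (2 * k%:R + 2) = 2 * ((k%:R + 1) * 'C(n, k.+1)%:R) :> K by ring.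
rewrite E mulrA [2 * _](_ : _ = n%:R *+ 2 - 2 * k%:R); last by ring.
by rewrite half_pchar; ring.
Qed.

Lemma binF_gt k : (n < k)%N -> binF k = 0.
Proof. by move=> ?; rewrite /binF bin_small. Qed.

Lemma harm_gapS k : harm_gap k.+1 = harm_gap k + (2 * k%:R + 1)^-1 - (2 * k%:R + 2)^-1.
Proof.
rewrite /harm_gap /harm doubleS !(big_nat_recr _.+1) //=.
have -> : k.*2.+1%:R = 2 * k%:R + 1 :> K by rewrite -muln2 -natr1 natrM; ring.
have -> : k.*2.+2%:R = 2 * (k%:R + 1) :> K by rewrite -muln2 -!natr1 natrM; ring.
have -> : 2 * k%:R + 2 = 2 * (k%:R + 1) :> K by ring.
rewrite -[k.+1%:R]natr1 invfM; set c := (k%:R + 1)^-1; set x := (2 * _ + 1)^-1.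
have cE : c = 2 * (2^-1 * c) by rewrite mulrA divff ?mul1r ?two_neq0.
by rewrite {2}cE; move: (2^-1 * c) => d; ring.
Qed.

(* Also valid at x = 0, which spares the case 2k + 1 = p in the recurrences. *)
Lemma sqr_mulV (x : K) : x ^+ 2 * x^-1 = x.
Proof. by have [->|x0] := eqVneq x 0; rewrite ?invr0 ?mulr0 // expr2 mulfK. Qed.

(** These four are f, g, F and G. Differentiating the squared coefficient with respect to k yields
    the factor 4 h_k, hence the 4 in g. The cubed one would yield 6 h_k; this 6 stands in front of G
    in [bin3h_poly_Clausen]. *)
Definition bin2_poly : {poly K} := \poly_(k < n.+1) (binF k ^+ 2).
Definition bin2h_poly : {poly K} := \poly_(k < n.+1) (4 * binF k ^+ 2 * harm_gap k).
Definition bin3_poly : {poly K} := \poly_(k < n.+1) (binF k ^+ 3 * (- 4) ^+ k).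
Definition bin3h_poly : {poly K} := \poly_(k < n.+1) (binF k ^+ 3 * (- 4) ^+ k * harm_gap k).

Lemma coef_bin2_poly k : bin2_poly`_k = binF k ^+ 2.
Proof. by rewrite coef_poly ltnS; case: leqP => // /binF_gt ->; rewrite expr0n. Qed.

Lemma coef_bin2h_poly k : bin2h_poly`_k = 4 * binF k ^+ 2 * harm_gap k.
Proof.
by rewrite coef_poly ltnS; case: leqP => // /binF_gt ->; rewrite expr0n mulr0 mul0r.
Qed.

Lemma coef_bin3_poly k : bin3_poly`_k = binF k ^+ 3 * (- 4) ^+ k.
Proof. by rewrite coef_poly ltnS; case: leqP => // /binF_gt ->; rewrite expr0n mul0r. Qed.

Lemma coef_bin3h_poly k : bin3h_poly`_k = binF k ^+ 3 * (- 4) ^+ k * harm_gap k.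
Proof. by rewrite coef_poly ltnS; case: leqP => // /binF_gt ->; rewrite expr0n !mul0r. Qed.

Definition coef_thetaE := (coef_theta, coefMn, coefXM, coefN, coefB, coefD).

Lemma mulX_eq0 (y : {poly K}) : 'X * y = 0 -> y = 0.
Proof. by move/eqP; rewrite mulf_eq0 polyX_eq0 => /eqP. Qed.

Lemma L2_bin2_poly : L2 bin2_poly = 0.
Proof.
apply: mulX_eq0; apply/polyP => -[|k]; rewrite L2_theta !coef_thetaE coef0 //=.
  by rewrite !(mulr0n, mul0r, mul0rn, subr0, addr0).
rewrite !coef_bin2_poly -[k.+1%:R]natr1.
have -> : (k%:R + 1) * ((k%:R + 1) * binF k.+1 ^+ 2) *+ 4
        = (binF k.+1 * (2 * k%:R + 2)) ^+ 2 :> K by ring.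
by rewrite binFS; ring.
Qed.

(** Expresses that f log X + g is annihilated by [L2], with the logarithm eliminated: the right-hand
    side is minus the terms in which log X is differentiated. *)
Lemma L2_bin2h_poly : L2 bin2h_poly = 4 * bin2_poly - 8 * (1 - 'X) * bin2_poly^`().
Proof.
apply/eqP; rewrite -subr_eq0; apply/eqP/mulX_eq0.
rewrite mulrBr L2_theta.
have -> : 'X * (4 * bin2_poly - 8 * (1 - 'X) * bin2_poly^`()) =
  'X * bin2_poly *+ 4 - theta bin2_poly *+ 8 + 'X * theta bin2_poly *+ 8 by rewrite /theta; ring.
apply/polyP => -[|k]; rewrite !coef_thetaE coef0 //=.
  by rewrite !(mulr0n, mul0r, mul0rn, subr0, addr0).
rewrite !coef_bin2_poly !coef_bin2h_poly -[k.+1%:R]natr1 harm_gapS.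
have := sqr_mulV (2 * k%:R + 1); have := sqr_mulV (2 * k%:R + 2); have := binFS k.
move: (_ + 1)^-1 (_ + 2)^-1 (binF _) (binF _) (harm_gap k) => z w c b h E Ey Ex.
apply/eqP; rewrite -subr_eq0; apply/eqP.
(* Every inverse is to meet the square of its own denominator, so that [sqr_mulV] removes it even
   when the denominator is 0. *)
transitivity (4 * (b * (2 * k%:R + 2)) ^+ 2 * (h + z)
  - 4 * b ^+ 2 * ((2 * k%:R + 2) ^+ 2 * w) - 4 * (2 * k%:R + 1) ^+ 2 * c ^+ 2 * h
  - 4 * (2 * k%:R + 1) * c ^+ 2 + 4 * (2 * k%:R + 2) * b ^+ 2); first by ring.
rewrite E Ey.
transitivity (4 * c ^+ 2 * ((2 * k%:R + 1) ^+ 2 * z - (2 * k%:R + 1))); first by ring.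
by rewrite Ex; ring.
Qed.

Lemma M3_bin3_poly : M3 bin3_poly = 0.
Proof.
apply: mulX_eq0; apply/polyP => -[|k]; rewrite M3_theta !coef_thetaE coef0 //=.
  by rewrite !(mulr0n, mul0r, mul0rn, subr0, addr0).
rewrite !coef_bin3_poly [_ ^+ k.+1]exprS -[k.+1%:R]natr1; move: ((- 4) ^+ k) (binFS k) => q.
move: (binF _) (binF _) => c b E.
transitivity (- 2 * q * ((b * (2 * k%:R + 2)) ^+ 3 + (2 * k%:R + 1) ^+ 3 * c ^+ 3)).
  by ring.
by rewrite E; ring.
Qed.

(** Expresses that F log X + 6 G is annihilated by [M3]: the terms in which the logarithm is
    differentiated add up to 12 [N2] F. *)
Lemma M3_bin3h_poly : M3 bin3h_poly = - 2 * N2 bin3_poly.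
Proof.
apply/eqP; rewrite -subr_eq0; apply/eqP/mulX_eq0.
rewrite mulrBr M3_theta (_ : 'X * (- 2 * _) = - (('X * N2 bin3_poly) *+ 2)); last by ring.
rewrite N2_theta opprK.
apply/polyP => -[|k]; rewrite !coef_thetaE coef0 //=.
  by rewrite !(mulr0n, mul0r, mul0rn, subr0, addr0).
rewrite !coef_bin3_poly !coef_bin3h_poly [_ ^+ k.+1]exprS -[k.+1%:R]natr1 harm_gapS.
move: ((- 4) ^+ k) => q.
have := sqr_mulV (2 * k%:R + 1); have := sqr_mulV (2 * k%:R + 2); have := binFS k.
move: (_ + 1)^-1 (_ + 2)^-1 (binF _) (binF _) (harm_gap k) => z w c b h E Ey Ex.
apply/eqP; rewrite -subr_eq0; apply/eqP.
transitivity (- 2 * q * (b * (2 * k%:R + 2)) ^+ 3 * (h + z)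
  + 2 * q * b ^+ 3 * (2 * k%:R + 2) * ((2 * k%:R + 2) ^+ 2 * w)
  - 2 * (2 * k%:R + 1) ^+ 3 * c ^+ 3 * q * h
  - 2 * q * b ^+ 3 * (2 * k%:R + 2) ^+ 2
  - 2 * q * c ^+ 3 * (2 * k%:R + 1) ^+ 2).
  by ring.
rewrite E Ey.
transitivity (2 * q * c ^+ 3 * (2 * k%:R + 1) * ((2 * k%:R + 1) ^+ 2 * z - (2 * k%:R + 1))).
  by ring.
by rewrite Ex; ring.
Qed.

End Sequences.

Section Linear.
Context (K : fieldType).
Implicit Types y z : {poly K}.

Lemma L2D y z : L2 (y + z) = L2 y + L2 z.
Proof. by rewrite /L2 !derivD; ring. Qed.

Lemma L2Cl c y : L2 (c%:P * y) = c%:P * L2 y.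
Proof. by rewrite /L2 !(derivM, derivC, mul0r, add0r); ring. Qed.

Lemma L3D y z : L3 (y + z) = L3 y + L3 z.
Proof. by rewrite /L3 !derivD; ring. Qed.

Lemma L3B y z : L3 (y - z) = L3 y - L3 z.
Proof. by rewrite /L3 !derivB; ring. Qed.

Lemma L3Cl c y : L3 (c%:P * y) = c%:P * L3 y.
Proof. by rewrite /L3 !(derivM, derivC, mul0r, add0r); ring. Qed.

Lemma deriv_reflect y : (y \Po (1 - 'X))^`() = - (y^`() \Po (1 - 'X)).
Proof. by rewrite deriv_comp derivB derivX -[1]/1%:P derivC sub0r mulrN1. Qed.

Lemma L2_reflect y : L2 (y \Po (1 - 'X)) = L2 y \Po (1 - 'X).
Proof.
have -> : L2 y = 4 * ('X - 'X^2) * y^`()^`() + 4 * (1 - 2 * 'X) * y^`() - y.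
  by rewrite /L2; ring.
rewrite comp_polyB comp_polyD !comp_polyM !comp_polyB !comp_polyM !rmorph_nat.
rewrite rmorph1 comp_polyX /L2 !(deriv_reflect, derivN).
ring.
Qed.

End Linear.

(** * Symmetries and Clausen's formula in characteristic p *)

Section Symmetry.
Context (K : fieldType) (n : nat) (chp : n.*2.+1 \in [pchar K]) (n_gt0 : (0 < n)%N).
Local Notation fP := (bin2_poly K n).
Local Notation gP := (bin2h_poly K n).
Local Notation hdiff := (harm_gap K).
Local Notation binK := (binF K n).

Lemma p_gt2 : (2 < n.*2.+1)%N.
Proof. by rewrite ltnS; have := n_gt0; rewrite -(leq_double 1). Qed.

Lemma size_bin2_poly : (size fP <= n.+1)%N.
Proof. exact: size_poly. Qed.

Lemma bin2_poly0 : fP.[0] = 1.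
Proof. by rewrite horner_coef0 coef_bin2_poly /binF bin0 expr1n. Qed.

Lemma bin2h_poly0 : gP.[0] = 0.
Proof. by rewrite horner_coef0 coef_bin2h_poly /harm_gap double0 subrr mulr0. Qed.

Definition bin2_sign : K := fP.[1].

Lemma size_1subX : size (1 - 'X : {poly K}) = 2.
Proof. by rewrite -opprB size_polyN size_XsubC. Qed.

(** Both sides solve [L2], have degree at most n and agree at 0, so uniqueness applies. *)
Lemma bin2_poly_reflect : fP \Po (1 - 'X) = bin2_sign%:P * fP.
Proof.
apply/eqP; rewrite -subr_eq0 -mulNr -rmorphN; apply/eqP.
apply: (L2_uniq K n.*2.+1 chp p_gt2).
- by rewrite L2D L2Cl L2_reflect L2_bin2_poly // comp_poly0 mulr0 addr0.
- rewrite -horner_coef0 hornerD horner_comp !hornerE bin2_poly0 mulr1.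
  by rewrite subr0 subrr.
- have sz : (n.+1 <= n.*2.+1)%N by rewrite ltnS -addnn leq_addr.
  rewrite (leq_trans (size_polyD _ _)) // geq_max size_comp_poly2 ?size_1subX //.
  rewrite (leq_trans size_bin2_poly) // mul_polyC (leq_trans (size_scale_leq _ _)) //.
  by rewrite (leq_trans size_bin2_poly).
Qed.

Lemma sqr_bin2_sign : bin2_sign ^+ 2 = 1.
Proof.
have := congr1 (horner^~ 1) bin2_poly_reflect.
by rewrite horner_comp !hornerE subrr bin2_poly0 -/bin2_sign.
Qed.

Lemma deriv_bin2_poly_reflect : fP^`() \Po (1 - 'X) = - (bin2_sign%:P * fP^`()).
Proof.
apply/eqP; rewrite -eqr_oppLR -deriv_reflect bin2_poly_reflect derivM derivC mul0r add0r.
by [].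
Qed.

(** The substitution j -> p - j changes the sign of every term. *)
Lemma harm_pchar : harm K n.*2 = 0.
Proof.
have pN2 := two_neq0 K n chp n_gt0.
suff E : harm K n.*2 = - harm K n.*2.
  by apply/(mulfI pN2); rewrite mulr0 mulr2n mulrDl mul1r {2}E subrr.
rewrite {1}/harm big_nat_rev /= /harm -sumrN; apply: eq_big_nat => j /andP[j1 jle].
rewrite -invrN; congr (_^-1); rewrite add1n subSS natrB; last by rewrite ltnW.
by rewrite (pcharf0 chp) sub0r.
Qed.

(** Induction from h_n = - H_n. Since 2n = -1, the substitution k -> n - 1 - k exchanges 2k + 1 and
    2k + 2 up to sign, so both sides have the same increments. *)
Lemma harm_gap_rev k : (k <= n)%N -> hdiff (n - k) = - hdiff k - harm K n.
Proof.
elim: k => [|k IH] k_le.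
  by rewrite subn0 /harm_gap harm_pchar double0 subrr oppr0.
have := harm_gapS K n chp n_gt0 (n - k.+1); rewrite -subSn // subSS IH ?(ltnW k_le) //.
rewrite (harm_gapS K n) // natrB // -[k.+1%:R]natr1 => E.
have E1 : 2 * (n%:R - (k%:R + 1)) + 1 = - (2 * k%:R + 2) :> K.
  transitivity (n%:R *+ 2 - (2 * k%:R + 1) : K); first by ring.
  by rewrite half_pchar //; ring.
have E2 : 2 * (n%:R - (k%:R + 1)) + 2 = - (2 * k%:R + 1) :> K.
  transitivity (n%:R *+ 2 - 2 * k%:R : K); first by ring.
  by rewrite half_pchar //; ring.
move: E; rewrite E1 E2 !invrN => /eqP; rewrite -subr_eq0 => /eqP E.
by apply/eqP; rewrite -subr_eq0 -oppr0 -E; apply/eqP; ring.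
Qed.

Lemma binF_rev k : (k <= n)%N -> binK (n - k) = binK k.
Proof. by move=> k_le; rewrite /binF bin_sub. Qed.

Lemma sum_rev (F : nat -> K) : \sum_(k < n.+1) F k = \sum_(k < n.+1) F (n - k)%N.
Proof. by rewrite (reindex_inj rev_ord_inj) /=; apply: eq_bigr => k _; rewrite subSS. Qed.

Lemma horner_bin2_poly x : fP.[x] = \sum_(k < n.+1) binK k ^+ 2 * x ^+ k.
Proof. exact: horner_poly. Qed.

Lemma horner_bin2h_poly x : gP.[x] = \sum_(k < n.+1) 4 * binK k ^+ 2 * hdiff k * x ^+ k.
Proof. exact: horner_poly. Qed.

Lemma bin2_poly_recip x : x != 0 -> x ^+ n * fP.[x^-1] = fP.[x].
Proof.
move=> x0; rewrite !horner_bin2_poly (sum_rev (fun k => binK k ^+ 2 * x^-1 ^+ k)) mulr_sumr.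
apply: eq_bigr => -[k /= k_le] _.
rewrite ltnS in k_le; rewrite binF_rev // mulrCA; congr (_ * _).
by rewrite -{1}(subnK k_le) exprD exprVn mulrAC mulfV ?expf_neq0 // mul1r.
Qed.

Lemma bin2h_poly_recip x : x != 0 -> x ^+ n * gP.[x^-1] = - gP.[x] - 4 * harm K n * fP.[x].
Proof.
move=> x0; rewrite horner_bin2_poly !horner_bin2h_poly.
rewrite (sum_rev (fun k => 4 * binK k ^+ 2 * hdiff k * x^-1 ^+ k)).
rewrite [x ^+ n * _]mulr_sumr [4 * _ * _]mulr_sumr -opprD -big_split -sumrN /=.
apply: eq_bigr => -[k /= k_le] _; rewrite ltnS in k_le.
rewrite binF_rev // harm_gap_rev // mulrCA.
have -> : x ^+ n * x^-1 ^+ (n - k) = x ^+ k.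
  by rewrite -{1}(subnK k_le) exprD exprVn mulrAC mulfV ?expf_neq0 // mul1r.
ring.
Qed.

Lemma bin2h_poly1 : gP.[1] = - 2 * harm K n * bin2_sign.
Proof.
have := bin2h_poly_recip 1 (oner_neq0 _); rewrite expr1n invr1 mul1r -/bin2_sign => E.
apply/(mulfI (two_neq0 K n chp n_gt0)).
have -> : 2 * gP.[1] = gP.[1] + gP.[1] by ring.
by rewrite {1}E; ring.
Qed.

End Symmetry.

(** * Clausen's formula, its logarithmic companion and the Wronskian *)

Section Clausen.
Context (K : fieldType) (n : nat) (chp : n.*2.+1 \in [pchar K]) (n_gt0 : (0 < n)%N).
Local Notation fP := (bin2_poly K n).
Local Notation gP := (bin2h_poly K n).
Local Notation FP := (bin3_poly K n).
Local Notation GP := (bin3h_poly K n).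
Local Notation eps := (bin2_sign K n).
Local Notation H := (harm K n).
Local Notation D := ('X - 'X^2 : {poly K}).

(** Chosen so that f log(1 - X) + [bin2h_refl] is [eps] times the reflection of the solution f log X
    + g. *)
Definition bin2h_refl : {poly K} := eps%:P * (gP \Po (1 - 'X)).

Lemma L2_bin2h_refl : L2 bin2h_refl = 4 * fP + 8 * 'X * fP^`().
Proof.
rewrite /bin2h_refl L2Cl L2_reflect L2_bin2h_poly // comp_polyB !comp_polyM comp_polyB comp_polyX.
rewrite !rmorph_nat rmorph1 bin2_poly_reflect // deriv_bin2_poly_reflect //.
have E : eps%:P * eps%:P = 1 :> {poly K} by rewrite -rmorphM /= -expr2 sqr_bin2_sign.
transitivity (eps%:P * eps%:P * (4 * fP + 8 * 'X * fP^`())); first by ring.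
by rewrite E mul1r.
Qed.

Lemma L2_gS : L2 (gP + bin2h_refl) = fP *+ 8 - (1 - 'X *+ 2) * fP^`() *+ 8.
Proof. by rewrite L2D L2_bin2h_poly // L2_bin2h_refl; ring. Qed.

Lemma size_XBX2 : size D = 3.
Proof. by rewrite addrC size_polyDl size_polyN size_polyXn ?size_polyX. Qed.

Lemma size_comp_D (Y : {poly K}) : (size Y <= n.+1)%N -> (size (Y \Po D) <= n.*2.+1)%N.
Proof.
move=> sY; rewrite (leq_trans (size_comp_poly_leq _ _)) // size_XBX2 /= muln2 ltnS leq_double.
by case: (size Y) sY.
Qed.

Lemma size_mul_half (y z : {poly K}) : (size y <= n.+1)%N -> (size z <= n.+1)%N ->
  (size (y * z)%R <= n.*2.+1)%N.
Proof.
move=> sy sz; rewrite (leq_trans (size_polyMleq _ _)) //.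
have := leq_add sy sz; rewrite addSn addnS addnn.
by case: (_ + _)%N.
Qed.

Lemma size_gS : (size (gP + bin2h_refl)%R <= n.+1)%N.
Proof.
rewrite (leq_trans (size_polyD _ _)) // geq_max size_poly /bin2h_refl mul_polyC.
rewrite (leq_trans (size_scale_leq _ _)) // size_comp_poly2 ?size_poly //.
exact: size_1subX.
Qed.

Lemma horner_D_0 : D.[0] = 0.
Proof. by rewrite hornerD hornerN hornerX hornerXn expr0n subrr. Qed.

Lemma L3_sqr : L3 (fP * fP) = 0.
Proof. by rewrite L3M L2_bin2_poly // deriv0 !mulr0 mul0rn !addr0. Qed.

(** Both sides solve [L3], the left one by [L3_comp] and the right one as a product of solutions of
    [L2]; both have constant term 1 and degree at most 2n < p. *)
Lemma bin3_poly_Clausen : FP \Po D = fP * fP.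
Proof.
apply/eqP; rewrite -subr_eq0 ; apply/eqP.
apply: (L3_uniq K n.*2.+1 chp (p_gt2 n n_gt0)).
- by rewrite L3B L3_sqr subr0 L3_comp M3_bin3_poly // comp_poly0 mulr0.
- rewrite -horner_coef0 hornerD hornerN horner_comp hornerM bin2_poly0 horner_D_0.
  by rewrite horner_coef0 coef_bin3_poly /binF bin0 !expr1n !mulr1 subrr.
- rewrite (leq_trans (size_polyD _ _)) // geq_max size_comp_D ?size_poly //=.
  by rewrite size_polyN size_mul_half ?size_poly.
Qed.

(** As log D = log X + log(1 - X), this compares F(D) log D + 6 G(D) with f times the sum of the
    logarithmic solutions f log X + g and f log(1 - X) + [bin2h_refl]. The logarithms cancel, and
    the multiple of f^2 adjusts the constant term. *)
Lemma bin3h_poly_Clausen : 6%:P * (GP \Po D) = fP * (gP + bin2h_refl) + (2 * H)%:P * (fP * fP).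
Proof.
apply/eqP; rewrite -subr_eq0; apply/eqP.
apply: (L3_uniq K n.*2.+1 chp (p_gt2 n n_gt0)).
- rewrite L3B L3D !L3Cl L3_sqr mulr0 addr0 L3_comp M3_bin3h_poly //.
  rewrite comp_polyM rmorphN !rmorph_nat /=.
  have -> : N2 FP \Po D = D * (1 - 4 * D) * (FP^`()^`() \Po D) + (1 - 8 * D) * (FP^`() \Po D)
     - fP * fP.
    rewrite /N2 comp_polyB comp_polyD !comp_polyM !comp_polyB !comp_polyM.
    by rewrite !rmorph_nat rmorph1 comp_polyX bin3_poly_Clausen.
  have d1 : (1 - 'X *+ 2) * (FP^`() \Po D) = fP^`() * fP + fP * fP^`().
    by rewrite -derivM -bin3_poly_Clausen deriv_comp !derivE; ring.
  have d2 : (1 - 'X *+ 2) ^+ 2 * (FP^`()^`() \Po D) - 2 * (FP^`() \Po D) =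
     fP^`()^`() * fP + 2 * fP^`() * fP^`() + fP * fP^`()^`().
    have := congr1 (fun y : {poly K} => y^`()) d1.
    rewrite derivM deriv_comp !derivE => E.
    by apply: etrans (etrans _ E) _; ring.
  have Lf := L2_bin2_poly K n chp; rewrite /L2 in Lf.
  rewrite L3M L2_bin2_poly // L2_gS deriv0 !mulr0 mul0rn !addr0 !derivE.
  move: (FP^`()^`() \Po D) (FP^`() \Po D) (fP) Lf d1 d2 => A B f Lf d1 d2.
  (* By 1 - 4D = (1 - 2X)^2, the terms in [A] and [B] combine into the left-hand sides of [d2] and
     [d1]. *)
  transitivity (- 12 * ((1 - 'X *+ 2) * D *
      ((1 - 'X *+ 2) ^+ 2 * A - 2 * B)
    + (1 - 6 * D) * ((1 - 'X *+ 2) * B) - (1 - 'X *+ 2) * (f * f))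
    - (D * f * (f^`() *+ 24 - (1 - 'X *+ 2) * f^`()^`() *+ 8)
      + ((1 - 'X *+ 2) * f + D * f^`() *+ 3) * (f *+ 8 - (1 - 'X *+ 2) * f^`() *+ 8))).
    by ring.
  rewrite d1 d2; transitivity (- 4 * (1 - 'X *+ 2) * f *
      (D * f^`()^`() *+ 4 + (1 - 'X *+ 2) * f^`() *+ 4 - f)); last by rewrite Lf mulr0.
  by ring.
- rewrite -horner_coef0 hornerD hornerN hornerD !hornerM horner_comp horner_D_0 !hornerC bin2_poly0.
  rewrite hornerD bin2h_poly0 /bin2h_refl hornerM hornerC horner_comp !hornerE subr0 bin2h_poly1 //.
  rewrite horner_coef0 coef_bin3h_poly /harm_gap double0 subrr !mulr0 sub0r.
  (* The constant term of [bin2h_refl] is [eps] g(1) = -2 H, which dictates the coefficient 2 H of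
     f^2. *)
  transitivity (2 * H * (eps ^+ 2 - 1)); first by rewrite /=; ring.
   by rewrite sqr_bin2_sign // subrr mulr0.
- rewrite (leq_trans (size_polyD _ _)) // geq_max size_polyN mul_polyC.
  rewrite (leq_trans (size_scale_leq _ _)) ?size_comp_D ?size_poly //=.
  rewrite (leq_trans (size_polyD _ _)) // geq_max size_mul_half ?size_poly ?size_gS //=.
  by rewrite mul_polyC (leq_trans (size_scale_leq _ _)) ?size_mul_half ?size_poly.
Qed.

(** D times the Wronskian of f and f log X + g; the derivative of the logarithm contributes D f^2 /
    X = (1 - X) f^2. *)
Definition wronskian (f g : {poly K}) : {poly K} :=
  D * (f * g^`() - f^`() * g) + (1 - 'X) * f ^+ 2.

(** Abel's identity, based on L2 y = 4 (D y')' - y. *)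
Lemma deriv_wronskian f g : (wronskian f g)^`() *+ 4 =
  f * (L2 g - (4 * f - 8 * (1 - 'X) * f^`())) - g * L2 f.
Proof. by rewrite /wronskian /L2 !derivE; ring. Qed.

Lemma deriv_wronskian0 : (wronskian fP gP)^`() *+ 4 = 0.
Proof.
rewrite deriv_wronskian (L2_bin2h_poly K n) // (L2_bin2_poly K n) //.
by move: fP gP => f g; rewrite mulr0 subr0 subrr mulr0.
Qed.

(** The derivative vanishes and the degree is at most p, so in characteristic p only the
    coefficients of 1 and X^p can survive; the values at 0 and 1 determine them. *)
Lemma wronskianE : wronskian fP gP = 1 - 'X^(n.*2.+1).
Proof.
have W' k : (0 < k)%N -> (k < n.*2.+1)%N -> (wronskian fP gP)`_k = 0.
  case: k => // k _ k_lt; have := congr1 (fun y : {poly K} => y`_k) deriv_wronskian0.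
  rewrite coefMn coef_deriv coef0 -[LHS]mulr_natr -[_ *+ k.+1]mulr_natr => /eqP; rewrite !mulf_eq0.
  rewrite (negPf (natf4_neq0 K n.*2.+1 chp (p_gt2 n n_gt0))) -(dvdn_pcharf chp).
  by rewrite gtnNdvd // !orbF => /eqP.
have sW : (size (wronskian fP gP) <= n.*2.+2)%N.
  have sP (y : {poly K}) : (size y <= n.+1)%N -> (size y^`() <= n)%N.
    move=> sy; have [->|y0] := eqVneq y 0; first by rewrite deriv0 size_poly0.
    by rewrite -ltnS (leq_trans (lt_size_deriv y0)).
  have [sf sg] : (size fP <= n.+1)%N /\ (size gP <= n.+1)%N by rewrite !size_poly.
  rewrite (leq_trans (size_polyD _ _)) // geq_max; apply/andP; split.
    rewrite (leq_trans (size_polyMleq _ _)) // size_XBX2 /= !ltnS.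
    rewrite (leq_trans (size_polyD _ _)) // size_polyN geq_max !(leq_trans (size_polyMleq _ _)) //.
      by have := leq_add (sP _ sf) sg; rewrite addnS addnn; case: (_ + _)%N.
    by have := leq_add sf (sP _ sg); rewrite addSn addnn; case: (_ + _)%N.
  rewrite (leq_trans (size_polyMleq _ _)) // size_1subX /= ltnS.
  exact: size_mul_half.
have [c WE] : exists c, wronskian fP gP = 1 + c%:P * 'X^(n.*2.+1).
  exists (wronskian fP gP)`_n.*2.+1; apply/polyP => k; rewrite [RHS]coefD coef1 coefCM coefXn.
  have [->|k_gt0] := posnP k.
    rewrite -horner_coef0 /wronskian hornerD hornerM horner_D_0 mul0r add0r !hornerE bin2_poly0.
    by rewrite /= subr0 !mulr1.
  have [k_lt|k_gt|->] := ltngtP k n.*2.+1; rewrite ?mulr0 ?mulr1 ?add0r //.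
    exact: W'.
  by rewrite nth_default // (leq_trans sW).
have : (wronskian fP gP).[1] = 0.
  rewrite /wronskian hornerD !hornerM !hornerD !hornerN hornerX hornerXn expr1n.
  by rewrite -polyC1 hornerC subrr !mul0r addr0.
rewrite WE hornerD hornerCM hornerXn expr1n mulr1 -polyC1 hornerC => /eqP.
by rewrite addrC addr_eq0 => /eqP ->; rewrite rmorphN1 mulN1r.
Qed.

End Clausen.

Arguments wronskian {K}.

(** * Values at a primitive sixth root of unity *)

Section Evaluation.
Context (K : fieldType) (n : nat) (chp : n.*2.+1 \in [pchar K]) (n_gt1 : (1 < n)%N).
Context (t : K) (tE : t ^+ 2 = t - 1).
Local Notation fP := (bin2_poly K n).
Local Notation gP := (bin2h_poly K n).
Local Notation gR := (bin2h_refl K n).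
Local Notation FP := (bin3_poly K n).
Local Notation GP := (bin3h_poly K n).
Local Notation eps := (bin2_sign K n).
Local Notation H := (harm K n).
Local Notation D := ('X - 'X^2 : {poly K}).

Let n_gt0 : (0 < n)%N := ltnW n_gt1.

Lemma three_neq0 : 3 != 0 :> K.
Proof. by rewrite -(dvdn_pcharf chp) gtnNdvd //; move: n_gt1; lia. Qed.

Lemma horner_reflect (y : {poly K}) x : (y \Po (1 - 'X)).[x] = y.[1 - x].
Proof. by rewrite horner_comp hornerD hornerN hornerX -polyC1 hornerC. Qed.

Lemma horner_XBX2 x : D.[x] = x - x ^+ 2.
Proof. by rewrite hornerD hornerN hornerX hornerXn. Qed.

Lemma horner_derivD x : D^`().[x] = 1 - 2 * x.
Proof.
by rewrite derivB derivX derivXn hornerD hornerN hornerMn hornerXn -polyC1 hornerC mulr_natl.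
Qed.

Lemma horner_wronskian (y z : {poly K}) x : (wronskian y z).[x] =
  D.[x] * (y.[x] * z^`().[x] - y^`().[x] * z.[x]) + (1 - x) * y.[x] ^+ 2.
Proof. by rewrite /wronskian horner_XBX2 !hornerE /=; ring. Qed.

Lemma theta_bin2_poly_recip x : x != 0 ->
  x ^+ n * (theta fP).[x^-1] = n%:R * fP.[x] - (theta fP).[x].
Proof.
have horner_theta z : (theta fP).[z] = \sum_(k < n.+1) k%:R * binF K n k ^+ 2 * z ^+ k.
  have -> : theta fP = \poly_(k < n.+1) (k%:R * binF K n k ^+ 2).
    apply/polyP => k; rewrite coef_theta coef_bin2_poly coef_poly ltnS.
    by case: leqP => // /binF_gt ->; rewrite expr0n mulr0.
  exact: horner_poly.
move=> x0; rewrite horner_bin2_poly !horner_theta.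
rewrite (sum_rev K n (fun k => k%:R * binF K n k ^+ 2 * x^-1 ^+ k)).
rewrite [x ^+ n * _]mulr_sumr [n%:R * _]mulr_sumr -sumrB.
apply: eq_bigr => -[k /= k_le] _; rewrite ltnS in k_le.
rewrite binF_rev // mulrCA natrB //.
have -> : x ^+ n * x^-1 ^+ (n - k) = x ^+ k.
  by rewrite -{1}(subnK k_le) exprD exprVn mulrAC mulfV ?expf_neq0 // mul1r.
ring.
Qed.

Let f := fP.[t].
Let f1 := fP^`().[t].
Let g := gP.[t].
Let g1 := gP^`().[t].
Let gr := eps * gP.[1 - t].
Let gr1 := - (eps * gP^`().[1 - t]).

Lemma horner_D_t : D.[t] = 1.
Proof. by rewrite horner_XBX2 tE; ring. Qed.

Lemma horner_D_1Bt : D.[1 - t] = 1.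
Proof. by rewrite horner_XBX2; transitivity (t - t ^+ 2); [ring|rewrite tE; ring]. Qed.

Lemma t_neq0 : t != 0.
Proof.
apply/eqP => t0; move: tE; rewrite t0 expr0n sub0r => /eqP.
by rewrite eq_sym oppr_eq0 oner_eq0.
Qed.

Lemma invr_t : t^-1 = 1 - t.
Proof.
apply: (mulfI t_neq0); rewrite divff ?t_neq0 //.
by transitivity (t - t ^+ 2); [rewrite tE|]; ring.
Qed.

Lemma bin2_poly_1Bt : fP.[1 - t] = eps * f.
Proof. by rewrite -horner_reflect bin2_poly_reflect // hornerM hornerC. Qed.

Lemma deriv_bin2_poly_1Bt : fP^`().[1 - t] = - (eps * f1).
Proof. by rewrite -horner_reflect deriv_bin2_poly_reflect // hornerN hornerM hornerC. Qed.

Lemma bin2h_refl_t : gR.[t] = gr.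
Proof. by rewrite hornerM hornerC horner_reflect. Qed.

Lemma deriv_bin2h_refl_t : gR^`().[t] = gr1.
Proof.
rewrite /bin2h_refl derivM derivC mul0r add0r deriv_reflect hornerM hornerC hornerN.
by rewrite horner_reflect mulrN.
Qed.

(* t is a fixed point of X -> 1/(1 - X), the composite of the two symmetries. *)
Lemma bin2_poly_t_fixed : t ^+ n * eps * f = f.
Proof. by rewrite -mulrA -bin2_poly_1Bt -invr_t bin2_poly_recip // t_neq0. Qed.

Lemma bin3_poly_1 : FP.[1] = f ^+ 2.
Proof. by rewrite expr2 -[f * f]hornerM -bin3_poly_Clausen // horner_comp horner_D_t. Qed.

Lemma deriv_bin3_poly_1 : FP^`().[1] * (1 - 2 * t) = 2 * f * f1.
Proof.
have := congr1 (fun y : {poly K} => y^`().[t]) (bin3_poly_Clausen K n chp n_gt0).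
rewrite /= deriv_comp derivM hornerM horner_comp horner_D_t horner_derivD => ->.
by rewrite hornerD !hornerM -/f -/f1; ring.
Qed.

Lemma bin3h_poly_1 : 6 * GP.[1] = f * (g + gr) + 2 * H * f ^+ 2.
Proof.
move: (bin3h_poly_Clausen K n chp n_gt0) bin2h_refl_t; move: (bin2h_refl K n) => r C rt.
have := congr1 (horner^~ t) C.
by rewrite hornerD !hornerM horner_comp horner_D_t !hornerC hornerD rt -/f -/g expr2.
Qed.

Lemma deriv_bin3h_poly_1 : 6 * GP^`().[1] * (1 - 2 * t) =
  f1 * (g + gr) + f * (g1 + gr1) + 4 * H * f * f1.
Proof.
move: (bin3h_poly_Clausen K n chp n_gt0) bin2h_refl_t deriv_bin2h_refl_t.
move: (bin2h_refl K n) => r C rt r1t.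
have := congr1 (fun y : {poly K} => y^`().[t]) C.
rewrite /= derivM derivC mul0r add0r deriv_comp.
rewrite !hornerM hornerC horner_comp horner_D_t horner_derivD mulrA => ->.
rewrite derivD !derivM derivD derivC mul0r add0r !hornerD.
rewrite !hornerM !hornerD !hornerM hornerC rt r1t -/f -/f1 -/g -/g1.
ring.
Qed.

(** The factor f remains because t^n [eps] = 1 is available only after multiplication by f(t), which
    may vanish. *)
Lemma bin2_poly_bin2h_t : f * (g + gr) = - 4 * H * f ^+ 2.
Proof.
have : f * gr = f * (t ^+ n * gP.[1 - t]).
  rewrite -{1}bin2_poly_t_fixed /gr.
  transitivity (eps ^+ 2 * f * (t ^+ n * gP.[1 - t])); first by ring.
  by rewrite sqr_bin2_sign // mul1r.
by move=> E; rewrite mulrDr E -invr_t bin2h_poly_recip ?t_neq0 // -/f -/g; ring.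
Qed.

(** The differentiated symmetries at the fixed point t, combined with 2n = -1, give f'(t) / f(t) = 1
    / (2 (1 - 2t)), here without dividing by f(t). *)
Lemma bin2_poly_deriv_t : 2 * f * f1 * (1 - 2 * t) = f ^+ 2.
Proof.
have := theta_bin2_poly_recip t t_neq0; rewrite invr_t /theta.
rewrite !hornerM !hornerX deriv_bin2_poly_1Bt -/f -/f1 => E.
have {}E : (n%:R *+ 2) * f ^+ 2 = 2 * t * (f * f1) - 2 * (1 - t) * (t ^+ n * eps * f) * f1.
  transitivity (2 * f * (n%:R * f)); first by ring.
  move/eqP: E; rewrite eq_sym subr_eq => /eqP ->; ring.
move: E; rewrite half_pchar // bin2_poly_t_fixed mulN1r => /eqP.
by rewrite eqr_oppLR => /eqP ->; ring.
Qed.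

Lemma wronskian_t : f * g1 - f1 * g + (1 - t) * f ^+ 2 = 1 - t ^+ n.*2.+1.
Proof.
have := congr1 (horner^~ t) (wronskianE K n chp n_gt0).
rewrite horner_wronskian horner_D_t mul1r -/f -/f1 -/g -/g1 => ->.
by rewrite hornerD hornerN hornerXn -polyC1 hornerC.
Qed.

(** The Wronskian formula at 1 - t, carried back to t by the reflection; additivity of Frobenius
    gives (1 - t)^p = 1 - t^p. *)
Lemma wronskian_1Bt : f1 * gr - f * gr1 + t * f ^+ 2 = t ^+ n.*2.+1.
Proof.
have := congr1 (horner^~ (1 - t)) (wronskianE K n chp n_gt0).
rewrite horner_wronskian horner_D_1Bt mul1r bin2_poly_1Bt deriv_bin2_poly_1Bt.
rewrite hornerD hornerN hornerXn -polyC1 hornerC => E.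
have FrE : (1 - t) ^+ n.*2.+1 = 1 - t ^+ n.*2.+1.
  have := pFrobenius_autB_comm chp (commr_sym (commr1 t)).
  by rewrite !pFrobenius_autE expr1n.
rewrite FrE in E; apply/eqP; rewrite -subr_eq0; apply/eqP.
have E2 := sqr_bin2_sign K n chp n_gt0.
move/eqP: E; rewrite -subr_eq0 => /eqP E.
transitivity (t * f ^+ 2 * (1 - eps ^+ 2)); last by rewrite E2 subrr mulr0.
by apply/eqP; rewrite -subr_eq0 -E; apply/eqP; rewrite /gr /gr1; ring.
Qed.

Let s2 : (1 - 2 * t) ^+ 2 = - 3.
Proof. by transitivity (1 - 4 * t + 4 * t ^+ 2); [|rewrite tE]; ring. Qed.

Let s_neq0 : 1 - 2 * t != 0.
Proof. by rewrite -sqrf_eq0 s2 oppr_eq0 three_neq0. Qed.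

Lemma deriv_bin3_poly_1_val : 3 * FP^`().[1] = - FP.[1].
Proof.
apply/eqP; rewrite -eqr_oppLR -mulNr -s2 bin3_poly_1 -bin2_poly_deriv_t -deriv_bin3_poly_1.
by apply/eqP; ring.
Qed.

Lemma bin3h_poly_1_val : 3 * GP.[1] = - H * FP.[1].
Proof.
apply/(mulfI (two_neq0 K n chp n_gt0)); rewrite mulrA -natrM.
by rewrite bin3h_poly_1 bin2_poly_bin2h_t bin3_poly_1; ring.
Qed.

Lemma cube_t : t ^+ 3 = -1.
Proof. by rewrite exprS tE mulrBr -expr2 tE; ring. Qed.

Lemma t_Frob1 : n.*2.+1 = 1 %[mod 3] -> t ^+ n.*2.+1 = t.
Proof.
move=> h; have -> : n.*2.+1 = (3 * (n %/ 3).*2).+1 by move: h; lia.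
by rewrite exprS exprM cube_t -signr_odd odd_double expr0 mulr1.
Qed.

Lemma t_Frob2 : n.*2.+1 = 2 %[mod 3] -> t ^+ n.*2.+1 = 1 - t.
Proof.
move=> h; have -> : n.*2.+1 = (3 * (n %/ 3).*2.+1).+2 by move: h; lia.
rewrite exprS exprS exprM cube_t -signr_odd /= odd_double expr1.
by rewrite mulrA -expr2 tE; ring.
Qed.

(** If f(t) were nonzero, then t^n [eps] = 1, hence t^(2n) = 1 and t^p = t. But t^p = 1 - t here,
    and t = 1 - t is excluded by (1 - 2t)^2 = -3. *)
Lemma bin3_poly_1_eq0 : n.*2.+1 = 2 %[mod 3] -> FP.[1] = 0.
Proof.
move=> /t_Frob2 tp; rewrite bin3_poly_1; apply/eqP; rewrite expf_eq0 /=.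
apply/negP => /negP f0; have : t ^+ n * eps = 1.
  by apply: (mulIf f0); rewrite mul1r bin2_poly_t_fixed.
move/(congr1 (fun x => x ^+ 2)); rewrite exprMn sqr_bin2_sign // mulr1 expr1n -exprM muln2 => tn.
move: tp s_neq0; rewrite exprS tn mulr1 => E /eqP[].
by transitivity (1 - t - t); [ring | rewrite -E subrr].
Qed.

(** If f(t) = 0, the Wronskian formulas read - f'(t) g = 1 - t and f'(t) [gr] = t. The symmetries
    give [gr]^2 = g^2, hence t^2 = (1 - t)^2, which contradicts 1 - 2t != 0. *)
Lemma bin2_poly_t_neq0 : n.*2.+1 = 1 %[mod 3] -> f != 0.
Proof.
move=> /t_Frob1 tp; apply/eqP => f0.
have g2 : gr ^+ 2 = g ^+ 2.
  have := bin2h_poly_recip K n chp n_gt0 t t_neq0.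
  rewrite -/f -/g f0 mulr0 subr0 invr_t => /(congr1 (fun x => x ^+ 2)).
  rewrite exprMn sqrrN -exprM muln2.
  have -> : t ^+ n.*2 = 1 by apply: (mulfI t_neq0); rewrite -exprS tp mulr1.
  by rewrite mul1r /gr exprMn sqr_bin2_sign // mul1r.
have := wronskian_t; have := wronskian_1Bt; rewrite tp f0 expr0n.
rewrite !mul0r !mulr0 !addr0 subr0 sub0r => w2 w1.
have : t ^+ 2 = (1 - t) ^+ 2 by rewrite -w1 sqrrN -w2 exprMn g2 -exprMn.
move=> E; have /eqP[] := s_neq0.
by transitivity ((1 - t) ^+ 2 - t ^+ 2); [ring | rewrite E subrr].
Qed.

Lemma deriv_bin3h_poly_1_val : 18 * GP^`().[1] = 3 - 3 * FP.[1] + 2 * H * FP.[1].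
Proof.
have p3 : n.*2.+1 = 1 %[mod 3] \/ n.*2.+1 = 2 %[mod 3].
  have : ~~ (3 %| n.*2.+1)%N.
    rewrite dvdn_prime2 ?(pcharf_prime chp) //.
    by move: n_gt1; lia.
  lia.
apply: (mulfI s_neq0).
(* The difference of the two Wronskian formulas supplies f (g1 + gr1), the part of the derivative of
   G that the symmetries leave open. *)
have F : f * g1 - f1 * g + (1 - t) * f ^+ 2 - (f1 * gr - f * gr1 + t * f ^+ 2)
   = 1 - 2 * t ^+ n.*2.+1 by rewrite wronskian_t wronskian_1Bt; ring.
case: p3 => hp.
  have E : g + gr = - 4 * H * f.
    by apply: (mulfI (bin2_poly_t_neq0 hp)); rewrite bin2_poly_bin2h_t; ring.
  rewrite t_Frob1 // in F.
  transitivity (3 * (6 * GP^`().[1] * (1 - 2 * t))); first by ring.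
  have -> : 6 * GP^`().[1] * (1 - 2 * t) =
      2 * f1 * (g + gr) + 4 * H * f * f1 - (1 - 2 * t) * f ^+ 2 + (1 - 2 * t).
    by rewrite deriv_bin3h_poly_1 -[X in _ = _ + X]F; ring.
  rewrite E bin3_poly_1; apply/(mulfI s_neq0).
  transitivity ((1 - 2 * t) ^+ 2 * (3 - 3 * f ^+ 2) - 6 * H * (2 * f * f1 * (1 - 2 * t))).
    by ring.
  by rewrite bin2_poly_deriv_t s2 [RHS]mulrA -expr2 s2; ring.
(* With f(t) = 0 the Wronskian formulas give f'(t) g and f'(t) [gr] separately. *)
have f0 : f = 0.
  by apply/eqP; rewrite -sqrf_eq0 -bin3_poly_1 bin3_poly_1_eq0.
have := wronskian_t; have := wronskian_1Bt; rewrite t_Frob2 // f0 expr0n.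
rewrite !mul0r !mulr0 !addr0 subr0 sub0r => w2 w1.
transitivity (3 * (6 * GP^`().[1] * (1 - 2 * t))); first by ring.
rewrite deriv_bin3h_poly_1 bin3_poly_1_eq0 // f0 (mulrDr f1) w2 -[f1 * g]opprK w1; ring.
Qed.

End Evaluation.

(** * Jacobi sums and the Hasse invariant *)

Section PowerSums.
Context (F : finFieldType).
Local Notation q := #|F|.

Lemma exists_expf_neq1 i : (0 < i < q.-1)%N -> exists2 y : F, y != 0 & y ^+ i != 1.
Proof.
move=> /andP[i_gt0 i_lt].
have [y /andP[y0 yi]|nex] := pickP (fun y : F => (y != 0) && (y ^+ i != 1)).
  by exists y.
have sz : size ('X^i - 1 : {poly F}) = i.+1 by rewrite -polyC1 size_XnsubC.
have := @max_poly_roots F ('X^i - 1) (enum (predC1 (0%R : F))).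
rewrite -size_poly_eq0 sz => /(_ isT) H.
have : (size (enum (predC1 (0%R : F))) < i.+1)%N.
  apply: H; last exact: enum_uniq.
  apply/allP => y; rewrite mem_enum inE => y0.
  have := nex y; rewrite y0 /= => /negbFE /eqP yi.
  by rewrite /root !hornerE yi subrr.
by rewrite -cardE cardC1 ltnS leqNgt i_lt.
Qed.

Lemma natr_card : #|F|%:R = 0 :> F.
Proof.
have : \sum_(x : F) x = \sum_(x : F) (x + 1) by rewrite (reindex_inj (addIr 1)).
rewrite big_split /= sumr_const => E; apply: (addrI (\sum_(x : F) x)).
by rewrite addr0.
Qed.

Lemma card_gt1 : (1 < q)%N.
Proof. by rewrite -cardsT (cardsD1 0) (cardsD1 1) !inE oner_eq0. Qed.

Lemma sum_expf_lt i : (i < q.-1)%N -> \sum_(x : F) x ^+ i = 0.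
Proof.
have [-> _|i_gt0 i_lt] := posnP i.
  by rewrite (eq_bigr (fun=> 1)) ?sumr_const ?natr_card // => x _; rewrite expr0.
have [|y y0 yi] := exists_expf_neq1 i; first by rewrite i_gt0.
apply/eqP; have : (1 - y ^+ i) * \sum_(x : F) x ^+ i == 0.
  rewrite mulrBl mul1r mulr_sumr {1}(reindex_inj (mulfI y0)) /= -sumrB big1 // => x _.
  by rewrite exprMn subrr.
by rewrite mulf_eq0 subr_eq0 eq_sym (negPf yi).
Qed.

Lemma expf_pred_card (x : F) : x != 0 -> x ^+ q.-1 = 1.
Proof.
move=> x0; apply: (mulfI x0); rewrite mulr1 -exprS prednK ?expf_card //.
exact: ltnW card_gt1.
Qed.

(** In this range q - 1 is the only positive multiple of q - 1. The exponent 0 gives q = 0, by the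
    convention 0^0 = 1. *)
Lemma sum_expf i : (i < q.-1.*2)%N -> \sum_(x : F) x ^+ i = - (i == q.-1)%:R.
Proof.
have q1 := card_gt1; have [i_lt _|i_gt i_lt|-> _] := ltngtP i q.-1.
- by rewrite sum_expf_lt // oppr0.
- rewrite oppr0 -[RHS](sum_expf_lt (i - q.-1)); last by move: i_gt i_lt; lia.
  apply: eq_bigr => x _; rewrite -{1}(subnK (ltnW i_gt)) exprD.
  have [->|x0] := eqVneq x 0; last by rewrite expf_pred_card // mulr1.
  by rewrite !expr0n subn_eq0 leqNgt i_gt mul0r.
  have q0 : (q.-1 == 0)%N = false by move: q1; lia.
  rewrite (bigD1 0) //= expr0n q0 add0r.
  rewrite (eq_bigr (fun=> 1)) => [|x x0]; last exact: expf_pred_card.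
  rewrite sumr_const (eq_card (B := predC1 0)) // cardC1 -subn1 natrB ?(ltnW q1) //.
  by rewrite natr_card sub0r.
Qed.

End PowerSums.

Section MulChar.
Context (F : finFieldType) (C : idomainType) (h : F -> C).
Hypothesis hM : forall x y, h (x * y) = h x * h y.

Lemma sum_mulchar y : y != 0 -> h y != 1 -> \sum_x h x = 0.
Proof.
move=> y0 hy; apply/eqP; have : (1 - h y) * \sum_x h x == 0.
  rewrite mulrBl mul1r mulr_sumr {1}(reindex_inj (mulfI y0)) /= -sumrB big1 // => x _.
  by rewrite hM subrr.
by rewrite mulf_eq0 subr_eq0 eq_sym (negPf hy).
Qed.

End MulChar.

(** * The sextic Jacobi sum over a field with 6k + 1 elements *)

Section JacobiSum.
Context (F : finFieldType) (k : nat) (k_gt0 : (0 < k)%N) (cardF : #|F| = (6 * k).+1).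
Context (w : F) (wE : w ^+ 2 = - w - 1).
Local Notation n := (3 * k)%N.
Local Notation m := (2 * k)%N.

Lemma six_k : 6 * k%:R = -1 :> F.
Proof.
by apply/eqP; rewrite -addr_eq0 -natrM natr1 -cardF natr_card.
Qed.

Lemma F2_neq0 : 2 != 0 :> F.
Proof.
apply/eqP => E; have /eqP := six_k.
have -> : 6 = 2 * 3 :> F by rewrite -natrM.
by rewrite E !mul0r eq_sym oppr_eq0 oner_eq0.
Qed.

Lemma F3_neq0 : 3 != 0 :> F.
Proof.
apply/eqP => E; have /eqP := six_k.
have -> : 6 = 3 * 2 :> F by rewrite -natrM.
by rewrite E !mul0r eq_sym oppr_eq0 oner_eq0.
Qed.

Lemma cube_w : w ^+ 3 = 1.
Proof. by rewrite exprS wE mulrBr mulrN -expr2 wE; ring. Qed.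

Lemma w_neq1 : w != 1.
Proof.
apply/eqP => w1; have /eqP[] := F3_neq0; move: wE; rewrite w1 expr1n => E.
transitivity (1 + 2 : F); first by ring.
by rewrite {1}E; ring.
Qed.

Lemma w_neq0 : w != 0.
Proof. by apply/eqP => w0; have /eqP := cube_w; rewrite w0 expr0n eq_sym oner_eq0. Qed.

Lemma w2_neq1 : w ^+ 2 != 1.
Proof.
apply/eqP => E; have /eqP[] := w_neq1; move: cube_w; rewrite exprS E mulr1; exact.
Qed.

Lemma w2_neqw : w ^+ 2 != w.
Proof.
apply/eqP => E; have /eqP[] := w_neq1; apply: (mulfI w_neq0).
by rewrite mulr1 -expr2.
Qed.

Lemma F1_neqN1 : 1 != -1 :> F.
Proof. by rewrite -addr_eq0 -[1 + 1]/(2%:R) F2_neq0. Qed.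

Lemma expn_cases (x : F) : x != 0 -> x ^+ n = 1 \/ x ^+ n = -1.
Proof.
move=> x0; have : (x ^+ n - 1) * (x ^+ n + 1) = 0.
  have := expf_pred_card F x x0; rewrite cardF /= (_ : 6 * k = n * 2)%N; last by lia.
  by rewrite exprM => E; transitivity ((x ^+ n) ^+ 2 - 1); [ring | rewrite E subrr].
by move/eqP; rewrite mulf_eq0 subr_eq0 addr_eq0 => /orP[] /eqP; [left|right].
Qed.

Lemma expm_cases (x : F) : x != 0 -> [\/ x ^+ m = 1, x ^+ m = w | x ^+ m = w ^+ 2].
Proof.
move=> x0; have : (x ^+ m - 1) * ((x ^+ m - w) * (x ^+ m - w ^+ 2)) = 0.
  have := expf_pred_card F x x0; rewrite cardF /= (_ : 6 * k = m * 3)%N; last by lia.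
  rewrite exprM; move: (x ^+ m) => y E; rewrite wE.
  transitivity (y ^+ 3 - 1 + (1 - y) * (w ^+ 2 + w + 1)); first by ring.
  by rewrite E wE; ring.
move/eqP; rewrite !mulf_eq0 !subr_eq0 => /orP[|/orP[]] /eqP.
- exact: Or31.
- exact: Or32.
- exact: Or33.
Qed.

(** The quadratic character, by Euler's criterion; its values are integers so that the norm equation
    below holds in Z rather than in F. *)
Definition chi (x : F) : int := (x ^+ n == 1)%:R - (x ^+ n == -1)%:R.

Lemma chi_1 x : x ^+ n = 1 -> chi x = 1.
Proof. by rewrite /chi => ->; rewrite eqxx (negPf F1_neqN1). Qed.

Lemma chi_N1 x : x ^+ n = -1 -> chi x = -1.
Proof. by rewrite /chi => ->; rewrite eqxx eq_sym (negPf F1_neqN1). Qed.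

Lemma expF0 i : (0 < i)%N -> 0 ^+ i = 0 :> F.
Proof. by rewrite expr0n lt0n => /negPf ->. Qed.

Lemma three_mul_gt0 : (0 < n)%N. Proof. by move: k_gt0; lia. Qed.
Lemma two_mul_gt0 : (0 < m)%N. Proof. by move: k_gt0; lia. Qed.

Lemma chi0 : chi 0 = 0.
Proof.
rewrite /chi (expF0 _ three_mul_gt0) eq_sym oner_eq0 eq_sym oppr_eq0 oner_eq0.
by rewrite subrr.
Qed.

Lemma chiE x : (chi x)%:~R = x ^+ n :> F.
Proof.
have [->|x0] := eqVneq x 0; first by rewrite chi0 (expF0 _ three_mul_gt0).
by case: (expn_cases x x0) => E; rewrite ?(chi_1 _ E) ?(chi_N1 _ E) E ?mulrN1z.
Qed.

Lemma chiM x y : chi (x * y) = chi x * chi y.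
Proof.
have [->|x0] := eqVneq x 0; first by rewrite mul0r chi0 mul0r.
have [->|y0] := eqVneq y 0; first by rewrite mulr0 chi0 mulr0.
case: (expn_cases x x0) => Ex; case: (expn_cases y y0) => Ey;
  rewrite ?(chi_1 _ Ex) ?(chi_N1 _ Ex) ?(chi_1 _ Ey) ?(chi_N1 _ Ey).
- by apply: chi_1; rewrite exprMn Ex Ey mulr1.
- by apply: chi_N1; rewrite exprMn Ex Ey mul1r.
- by apply: chi_N1; rewrite exprMn Ex Ey mulr1.
- by apply: chi_1; rewrite exprMn Ex Ey mulrNN mulr1.
Qed.

Lemma chi_sqr x : x != 0 -> chi x * chi x = 1.
Proof. by move=> /expn_cases[] E; rewrite ?(chi_1 _ E) ?(chi_N1 _ E). Qed.

Lemma chi1 : chi 1 = 1. Proof. by apply: chi_1; rewrite expr1n. Qed.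

Lemma chiV x : chi x^-1 = chi x.
Proof.
have [->|x0] := eqVneq x 0; first by rewrite invr0.
have cx : chi x != 0 by apply/eqP => c0; have := chi_sqr x x0; rewrite c0.
by apply: (mulfI cx); rewrite -chiM divff // chi1 chi_sqr.
Qed.

Lemma exists_chiN1 : exists2 y : F, y != 0 & y ^+ n = -1.
Proof.
have [|y y0 yn] := exists_expf_neq1 F n; first by rewrite cardF; move: k_gt0; lia.
by exists y => //; case: (expn_cases y y0) yn => ->; rewrite ?eqxx.
Qed.

Lemma sum_chi : \sum_x chi x = 0.
Proof.
have [y y0 yn] := exists_chiN1.
by apply: (sum_mulchar F int chi chiM y y0); rewrite chi_N1.
Qed.

Lemma sum_chi_shift a : a != 0 -> \sum_x chi (x + a) * chi x = -1.
Proof.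
move=> a0; rewrite (bigD1 0) //= chi0 mulr0 add0r.
rewrite (eq_bigr (fun x => chi (1 + a * x^-1))) => [|x x0]; last first.
  have -> : x + a = (1 + a / x) * x by rewrite mulrDl mul1r mulfVK.
  by rewrite chiM -mulrA chi_sqr // mulr1.
rewrite (reindex_inj invr_inj) /= (eq_bigl (fun x => x != 0)) => [|x]; last by rewrite invr_eq0.
under eq_bigr do rewrite invrK.
have : \sum_x chi (1 + a * x) = 0.
  rewrite -[RHS]sum_chi [RHS](reindex_inj (addrI 1)) /=.
  by rewrite [RHS](reindex_inj (mulfI a0)).
rewrite (bigD1 0) //= mulr0 addr0 chi1 => /eqP; rewrite addrC addr_eq0 => /eqP //.
Qed.

Context (C : numFieldType) (W : C) (WE : W ^+ 2 = - W - 1).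

(* The cubic character of F with values 1, W, W^2 (and 0 at 0). *)
Definition psi (x : F) : C :=
  (x ^+ m == 1)%:R + (x ^+ m == w)%:R * W + (x ^+ m == w ^+ 2)%:R * W ^+ 2.

Lemma psi_1 x : x ^+ m = 1 -> psi x = 1.
Proof.
rewrite /psi => ->; rewrite eqxx !(eq_sym 1) (negPf w_neq1) (negPf w2_neq1).
by rewrite !mul0r !addr0.
Qed.

Lemma psi_w x : x ^+ m = w -> psi x = W.
Proof.
rewrite /psi => ->; rewrite eqxx (eq_sym w (w ^+ 2)) (negPf w_neq1) (negPf w2_neqw).
by rewrite mul0r mul1r add0r addr0.
Qed.

Lemma psi_w2 x : x ^+ m = w ^+ 2 -> psi x = W ^+ 2.
Proof.
rewrite /psi => ->; rewrite eqxx (negPf w2_neq1) (negPf w2_neqw).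
by rewrite mul0r mul1r !add0r.
Qed.

Lemma psi0 : psi 0 = 0.
Proof.
rewrite /psi (expF0 _ two_mul_gt0) !(eq_sym 0) oner_eq0 (negPf w_neq0) expf_eq0 (negPf w_neq0).
by rewrite !mul0r !addr0.
Qed.

Lemma cube_W : W ^+ 3 = 1.
Proof. by rewrite exprS WE mulrBr mulrN -expr2 WE; ring. Qed.

Lemma w_mul : (w * w = w ^+ 2) * (w * w ^+ 2 = 1) * (w ^+ 2 * w = 1) * (w ^+ 2 * w ^+ 2 = w).
Proof.
by rewrite -expr2 -exprS -exprSr -exprD cube_w (exprS w 3) cube_w mulr1.
Qed.

Lemma W_mul : (W * W = W ^+ 2) * (W * W ^+ 2 = 1) * (W ^+ 2 * W = 1) * (W ^+ 2 * W ^+ 2 = W).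
Proof.
by rewrite -expr2 -exprS -exprSr -exprD cube_W (exprS W 3) cube_W mulr1.
Qed.

Lemma psiM x y : psi (x * y) = psi x * psi y.
Proof.
have [->|x0] := eqVneq x 0; first by rewrite mul0r psi0 mul0r.
have [->|y0] := eqVneq y 0; first by rewrite mulr0 psi0 mulr0.
have H : (x * y) ^+ m = x ^+ m * y ^+ m by rewrite exprMn.
case: (expm_cases x x0) => Ex; case: (expm_cases y y0) => Ey;
  rewrite ?(psi_1 _ Ex) ?(psi_w _ Ex) ?(psi_w2 _ Ex);
  rewrite ?(psi_1 _ Ey) ?(psi_w _ Ey) ?(psi_w2 _ Ey);
  rewrite ?mul1r ?mulr1 ?W_mul;
  move: H; rewrite Ex Ey ?mul1r ?mulr1 ?w_mul; [exact: psi_1|exact: psi_w|exact: psi_w2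
   |exact: psi_w|exact: psi_w2|exact: psi_1|exact: psi_w2|exact: psi_1|exact: psi_w].
Qed.

Lemma psi_cube x : x != 0 -> psi x ^+ 3 = 1.
Proof.
move=> /expm_cases[] E; rewrite ?(psi_1 _ E) ?(psi_w _ E) ?(psi_w2 _ E) ?expr1n ?cube_W //.
by rewrite -exprM mulnC exprM cube_W expr1n.
Qed.

Lemma W_neq1 : W != 1.
Proof.
apply/eqP => W1; have /eqP[] : 3%:R != 0 :> C by rewrite pnatr_eq0.
move: WE; rewrite W1 expr1n => E.
transitivity (1 + 2 : C); first by ring.
by rewrite {1}E; ring.
Qed.

Lemma W2_neq1 : W ^+ 2 != 1.
Proof.
apply/eqP => E; have /eqP[] := W_neq1; move: cube_W; rewrite exprS E mulr1; exact.
Qed.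

Lemma sum_psi : \sum_x psi x = 0.
Proof.
have [|y y0 ym] := exists_expf_neq1 F m; first by rewrite cardF; move: k_gt0; lia.
apply: (sum_mulchar F C psi psiM y y0).
case: (expm_cases y y0) ym => E; first by rewrite E eqxx.
  by rewrite psi_w // W_neq1.
by rewrite psi_w2 // W2_neq1.
Qed.

Lemma sum_chi_psi : \sum_x (chi x)%:~R * psi x = 0.
Proof.
have [y y0 yn] := exists_chiN1.
(* The cube of a nonresidue y has psi = 1 and chi = -1. *)
apply: (sum_mulchar F C (fun x => (chi x)%:~R * psi x) _ (y ^+ 3)).
- by move=> x z; rewrite chiM psiM intrM mulrACA.
- by rewrite expf_neq0.
rewrite psi_1; last first.
  rewrite -exprM (_ : 3 * m = 6 * k)%N; last by lia.
  by have := expf_pred_card F y y0; rewrite cardF.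
rewrite chi_N1; last by rewrite exprAC yn exprS sqrrN expr1n mulr1.
by rewrite mulr1 eq_sym -addr_eq0 -[1 + 1]/(2%:R) pnatr_eq0.
Qed.

Lemma sum_chi_pair v : v != 0 ->
  \sum_(y | y != 0) chi ((1 + v * y) * (1 + y)) =
  if v == 1 then #|F|%:R - 2 else - chi v - 1.
Proof.
move=> v0; apply: (addrI (chi ((1 + v * 0) * (1 + 0)))).
transitivity (\sum_y chi ((1 + v * y) * (1 + y))); first by rewrite [RHS](bigD1 0).
rewrite mulr0 !addr0 mulr1 chi1.
have [->|v1] := eqVneq v 1.
  rewrite (eq_bigr (fun y => chi (1 + y) * chi (1 + y))) => [|y _]; last by rewrite mul1r chiM.
  rewrite -(reindex_inj (addrI 1) (P := predT) (F := fun y => chi y * chi y)) /=.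
  rewrite (bigD1 0) //= chi0 mul0r add0r (eq_bigr (fun=> 1)) => [|y y0]; last exact: chi_sqr.
  rewrite sumr_const (eq_card (B := predC1 0)) // cardC1 -subn1 natrB ?(ltnW (card_gt1 F)) //.
  ring.
transitivity (- chi v); last by ring.
rewrite (eq_bigr (fun y => chi v * (chi (1 + y + (v^-1 - 1)) * chi (1 + y)))) => [|y _]; last first.
  rewrite -!chiM mulrA; congr (chi (_ * _)).
  by transitivity (v / v + v * y); [rewrite divff | ring].
rewrite -mulr_sumr.
rewrite -(reindex_inj (addrI 1) (P := predT) (F := fun y => chi (y + (v^-1 - 1)) * chi y)) /=.
rewrite sum_chi_shift ?mulrN1 // subr_eq0; apply: contra v1 => /eqP E.
by rewrite -[v]invrK E invr1.
Qed.

(** The Jacobi sum of [chi] and [psi]: 1 + x may replace 1 - x since psi(-1) = 1. Its conjugate is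
    formed with psi^2, the inverse character of [psi]. *)
Definition jacobi : C := \sum_x (chi (1 + x))%:~R * psi x.
Definition jacobi_conj : C := \sum_x (chi (1 + x))%:~R * psi x ^+ 2.

(** The substitution x = v y makes psi(y) disappear and leaves the inner sums of [sum_chi_pair]. The
    value v = 1 gives q - 2, and the vanishing sums of [psi] and of [chi] times [psi] give the
    missing 2. *)
Lemma jacobi_norm : jacobi * jacobi_conj = #|F|%:R.
Proof.
rewrite /jacobi_conj mulr_sumr (bigD1 0) //= psi0 expr0n !mulr0 add0r.
rewrite (eq_bigr (fun y => \sum_v psi v * (chi ((1 + v * y) * (1 + y)))%:~R))
  => [|y y0]; last first.
  rewrite /jacobi (reindex_inj (mulIf y0)) /= mulr_suml; apply: eq_bigr => v _.
  rewrite psiM chiM intrM -[RHS]mulr1 -(psi_cube y y0); ring.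
rewrite exchange_big /=.
under eq_bigr => v _ do rewrite -mulr_sumr -rmorph_sum /=.
rewrite (bigD1 1) //= sum_chi_pair ?oner_neq0 // eqxx psi_1 ?expr1n // mul1r.
rewrite (eq_bigr (fun v => - ((chi v)%:~R * psi v) - psi v)) => [|v v1]; last first.
  have [->|v0] := eqVneq v 0; first by rewrite psi0 !(mulr0, mul0r) oppr0 addr0.
  by rewrite sum_chi_pair // (negPf v1) rmorphB rmorphN /=; ring.
rewrite big_split /= !sumrN.
have := sum_chi_psi; rewrite (bigD1 1) //= chi1 psi_1 ?expr1n // mulr1 => /eqP.
rewrite addrC addr_eq0 => /eqP ->.
have := sum_psi; rewrite (bigD1 1) //= psi_1 ?expr1n // => /eqP.
rewrite addrC addr_eq0 => /eqP ->.
by rewrite rmorphB /= !rmorph_nat; ring.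
Qed.

(* The coefficients of the Jacobi sum on 1, W, W^2, for u = 1, w, w^2. *)
Definition chi_class (u : F) : int := \sum_x (x ^+ m == u)%:R * chi (1 + x).

Lemma chi_classE u : (chi_class u)%:~R = \sum_x (x ^+ m == u)%:R * (chi (1 + x))%:~R :> C.
Proof. by rewrite rmorph_sum; apply: eq_bigr => x _; rewrite rmorphM /= rmorph_nat. Qed.

Lemma jacobiE : jacobi =
  (chi_class 1)%:~R + (chi_class w)%:~R * W + (chi_class (w ^+ 2))%:~R * W ^+ 2.
Proof.
rewrite !chi_classE !mulr_suml -!big_split /=; apply: eq_bigr => x _.
by rewrite /psi; ring.
Qed.

Lemma psi_sqr x : psi x ^+ 2 =
  (x ^+ m == 1)%:R + (x ^+ m == w)%:R * W ^+ 2 + (x ^+ m == w ^+ 2)%:R * W.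
Proof.
have [->|x0] := eqVneq x 0.
  rewrite psi0 (expF0 _ two_mul_gt0) !(eq_sym 0) oner_eq0 (negPf w_neq0) expf_eq0 (negPf w_neq0).
  by rewrite !mul0r !addr0 expr0n.
case: (expm_cases x x0) => E; rewrite ?(psi_1 _ E) ?(psi_w _ E) ?(psi_w2 _ E) E;
  rewrite eqxx ?(eq_sym 1) ?(eq_sym w (w ^+ 2)) ?(negPf w_neq1) ?(negPf w2_neq1) ?(negPf w2_neqw).
- by rewrite expr1n !mul0r !addr0.
- by rewrite mul0r mul1r add0r addr0.
- by rewrite mul0r mul1r !add0r expr2 W_mul.
Qed.

Lemma jacobi_conjE : jacobi_conj =
  (chi_class 1)%:~R + (chi_class w)%:~R * W ^+ 2 + (chi_class (w ^+ 2))%:~R * W.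
Proof.
rewrite !chi_classE !mulr_suml -!big_split /=; apply: eq_bigr => x _.
by rewrite psi_sqr; ring.
Qed.

Lemma chi_class_sum : chi_class 1 + chi_class w + chi_class (w ^+ 2) = -1.
Proof.
rewrite -!big_split /=.
have := sum_chi; rewrite (reindex_inj (addrI 1)) /= (bigD1 0) //= addr0 chi1 => /eqP.
rewrite addrC addr_eq0 => /eqP <-; rewrite (bigD1 0) //= (expF0 _ two_mul_gt0).
rewrite !(eq_sym 0) oner_eq0 (negPf w_neq0) expf_eq0 (negPf w_neq0) !mul0r !add0r.
apply: eq_bigr => x x0.
case: (expm_cases x x0) => E; rewrite E;
  rewrite eqxx ?(eq_sym 1) ?(eq_sym w (w ^+ 2)) ?(negPf w_neq1) ?(negPf w2_neq1) ?(negPf w2_neqw);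
  by rewrite ?mul0r ?mul1r ?addr0 ?add0r.
Qed.

(** The substitution x -> 1/x exchanges the classes of w and w^2 and multiplies chi(1 + x) by
    chi(x). The difference thus has terms chi(1 + x) (1 - chi(x)), with 1 - chi(x) equal to 0 or
    2. *)
Lemma chi_class_even : exists b, chi_class w - chi_class (w ^+ 2) = 2 * b.
Proof.
exists (\sum_(x | x ^+ m == w) (chi x == -1)%:R * chi (1 + x)).
have -> : chi_class (w ^+ 2) = \sum_x (x ^+ m == w)%:R * (chi (1 + x) * chi x).
  rewrite /chi_class (reindex_inj invr_inj) /=; apply: eq_bigr => x _.
  have [->|x0] := eqVneq x 0.
    by rewrite invr0 chi0 (expF0 _ two_mul_gt0) !(eq_sym 0) expf_eq0 (negPf w_neq0) !mul0r.
  have -> : (x^-1 ^+ m == w ^+ 2) = (x ^+ m == w).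
    rewrite exprVn -(inj_eq invr_inj) invrK -(inj_eq (mulfI (expf_neq0 2 w_neq0))).
    by rewrite divff ?expf_neq0 ?w_neq0 // -(inj_eq (mulfI w_neq0)) mulrA w_mul mul1r mulr1.
  have -> : 1 + x^-1 = (1 + x) * x^-1 by rewrite mulrDl mul1r divff // addrC.
  by rewrite chiM chiV.
rewrite /chi_class -sumrB [in RHS]big_mkcond /= mulr_sumr; apply: eq_bigr => x _.
case: eqP => E; last by rewrite !mul0r subrr mulr0.
have x0 : x != 0.
  apply: contraTneq isT => x0; move: E w_neq0.
  by rewrite x0 (expF0 _ two_mul_gt0) => ->; rewrite eqxx.
by case: (expn_cases x x0) => Ex; rewrite ?(chi_1 _ Ex) ?(chi_N1 _ Ex) /=; ring.
Qed.

(* Four times the norm of the Jacobi sum in Z[W]. *)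
Lemma chi_class_norm :
  (1 + 3 * chi_class 1) ^+ 2 + 3 * (chi_class w - chi_class (w ^+ 2)) ^+ 2 = 4 * #|F|%:R.
Proof.
have := jacobi_norm; rewrite jacobiE jacobi_conjE WE; have := chi_class_sum.
move: (chi_class 1) (chi_class w) (chi_class (w ^+ 2)) => a b c abc E.
have {}E : (a ^+ 2 + b ^+ 2 + c ^+ 2 - a * b - a * c - b * c)%:~R = #|F|%:R%:~R :> C.
  rewrite rmorph_nat -E !(rmorphB, rmorphD, rmorphM, rmorphXn) /=.
  have W0 : W ^+ 2 + W + 1 = 0 by rewrite WE; ring.
  apply/eqP; rewrite -subr_eq0 -(mulr0 ((b%:~R - c%:~R) ^+ 2 : C)) -W0.
  by apply/eqP; ring.
move/intr_inj: E => <-.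
have -> : a = - 1 - b - c by rewrite -abc; ring.
ring.
Qed.

End JacobiSum.

(** * The Hasse invariant of the Legendre curve at t *)

Section Hasse.
Context (F : finFieldType) (k : nat) (k_gt0 : (0 < k)%N) (cardF : #|F| = (6 * k).+1).
Context (t : F) (tE : t ^+ 2 = t - 1).
Local Notation n := (3 * k)%N.
Local Notation m := (2 * k)%N.

Lemma sum_expf_card i : (i < 12 * k)%N -> \sum_(x : F) x ^+ i = - (i == 6 * k)%N%:R.
Proof. by move=> i_lt; rewrite sum_expf cardF //=; move: i_lt; lia. Qed.

Lemma sum_expf_shift (e : 'I_n.+1 -> nat) (c : 'I_n.+1 -> F) (i0 : 'I_n.+1) :
  (forall i, (e i < 12 * k)%N) -> (forall i, (e i == 6 * k)%N = (i == i0)) ->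
  \sum_(x : F) \sum_i c i * x ^+ e i = - c i0.
Proof.
move=> e_lt eE; rewrite exchange_big /= (bigD1 i0) //= [X in _ + X]big1 => [|i ii0].
  by rewrite -mulr_sumr sum_expf_card // eE eqxx addr0 mulrN1.
by rewrite -mulr_sumr sum_expf_card // eE (negPf ii0) oppr0 mulr0.
Qed.

Lemma sum_expf_shift0 (e : 'I_n.+1 -> nat) (c : 'I_n.+1 -> F) :
  (forall i, (e i < 6 * k)%N) -> \sum_(x : F) \sum_i c i * x ^+ e i = 0.
Proof.
move=> e_lt; rewrite exchange_big /= big1 // => i _.
by rewrite -mulr_sumr sum_expf_lt ?mulr0 // cardF.
Qed.

Lemma sum_cubic : \sum_(x : F) (x ^+ 3 + 1) ^+ n = - 'C(n, m)%:R.
Proof.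
have mn : (m < n.+1)%N by lia.
rewrite (eq_bigr (fun x => \sum_(i < n.+1) 'C(n, i)%:R * x ^+ (3 * i))) => [|x _]; last first.
  by rewrite exprD1n; apply: eq_bigr => i _; rewrite -exprM mulr_natl.
rewrite (@sum_expf_shift (fun i => 3 * i)%N (fun i => 'C(n, i)%:R) (Ordinal mn)) //= => -[i i_lt].
  by rewrite /=; move: i_lt k_gt0; lia.
by rewrite -val_eqE /=; lia.
Qed.

(** At y = x^(2k), the sum 1 + y + y^2 is 3 if y = 1 and 0 at the other cube roots of unity; x = 0
    accounts for the summand 1. *)
Lemma chi_class_hasse : (1 + 3 * chi_class F k 1)%:~R = - 'C(n, m)%:R :> F.
Proof.
have wE : (- t) ^+ 2 = - - t - 1 by rewrite sqrrN tE opprK.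
have -> : (1 + 3 * chi_class F k 1)%:~R =
    \sum_(x : F) (1 + x ^+ m + x ^+ (4 * k)) * (1 + x) ^+ n :> F.
  rewrite rmorphD rmorphM /= rmorph_nat rmorph_sum /= (bigD1 0) //= [RHS](bigD1 0) //=.
  have m0 : (0 < m)%N by move: k_gt0; lia.
  rewrite !addr0 !expr1n mulr1 (expF0 F) // eq_sym oner_eq0 mul0r add0r.
  have k4 : (0 < 4 * k)%N by move: k_gt0; lia.
  rewrite (expF0 F _ k4) !addr0.
  congr (_ + _); rewrite mulr_sumr; apply: eq_bigr => x x0.
  rewrite rmorphM /= rmorph_nat (chiE F k k_gt0 cardF) (_ : 4 * k = m * 2)%N; last by lia.
  rewrite [x ^+ (m * 2)]exprM mulrA; congr (_ * _).
  have W := w_neq1 F k cardF (-t) wE; have W2 := w2_neq1 F k cardF (-t) wE.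
  case: (expm_cases F k k_gt0 cardF (-t) wE x x0) => ->.
  - by rewrite eqxx expr1n mulr1; ring.
  - by rewrite (negPf W) mulr0 wE; ring.
  - rewrite (negPf W2) mulr0 -exprM (exprSr _ 3) (cube_w F (-t) wE) mul1r wE; ring.
have mn : (m < n.+1)%N by lia.
pose S a := \sum_(x : F) \sum_(i < n.+1) 'C(n, i)%:R * x ^+ (i + a).
have -> : \sum_(x : F) (1 + x ^+ m + x ^+ (4 * k)) * (1 + x) ^+ n = S 0%N + S m + S (4 * k)%N.
  rewrite /S -!big_split /=; apply: eq_bigr => x _.
  rewrite [1 + x]addrC exprD1n mulr_sumr -!big_split /=; apply: eq_bigr => i _.
  by rewrite !exprD expr0; ring.
(* Only in [S (4 * k)] can an exponent reach 6k = q - 1, namely at i = 2k. *)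
rewrite /S sum_expf_shift0 => [|[i i_lt]]; last by rewrite /= addn0; move: i_lt k_gt0; lia.
rewrite sum_expf_shift0 => [|[i i_lt]]; last by rewrite /=; move: i_lt k_gt0; lia.
rewrite !add0r (@sum_expf_shift (fun i => i + 4 * k)%N (fun i => 'C(n, i)%:R) (Ordinal mn)) //=
  => -[i i_lt].
  by rewrite /=; move: i_lt k_gt0; lia.
by rewrite -val_eqE /=; lia.
Qed.

(** After expansion the exponent n + i + (n - j) equals q - 1 = 2n exactly when i = j, which leaves
    the squared binomial coefficients of f. *)
Lemma legendre_sum : \sum_(x : F) (x * (x - 1) * (x - t)) ^+ n = - (- 1) ^+ n * (bin2_poly F n).[t].
Proof.
rewrite horner_bin2_poly mulr_sumr.
have -> : \sum_(x : F) (x * (x - 1) * (x - t)) ^+ n =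
  \sum_(i < n.+1) \sum_(x : F) \sum_(j < n.+1)
     ((- 1) ^+ n * 'C(n, i)%:R * (- 1) ^+ i * 'C(n, j)%:R * (- t) ^+ j) * x ^+ (n + i + (n - j)).
  rewrite exchange_big /=; apply: eq_bigr => x _.
  rewrite !exprMn (_ : x - 1 = - 1 * (- x + 1)); last by ring.
  rewrite exprMn exprD1n exprDn !(mulr_sumr, mulr_suml) [RHS]exchange_big /=.
  apply: eq_bigr => j _; rewrite mulr_suml; apply: eq_bigr => i _.
  rewrite !exprD -[_ *+ 'C(n, i)]mulr_natr -[_ *+ 'C(n, j)]mulr_natr.
  rewrite -[- x]mulN1r exprMn.
  ring.
apply: eq_bigr => i _.
rewrite (@sum_expf_shift (fun j => n + i + (n - j))%N
  (fun j => (- 1) ^+ n * 'C(n, i)%:R * (- 1) ^+ i * 'C(n, j)%:R * (- t) ^+ j) i).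
- rewrite /binF !mulNr; congr (- _).
  have -> : t ^+ i = (-1) ^+ i * (- t) ^+ i by rewrite -exprMn mulN1r opprK.
  by ring.
- by case: i => i /=; case=> j /=; move: k_gt0; lia.
- by case: i => i i_lt; case=> j j_lt; rewrite -val_eqE /=; move: i_lt j_lt k_gt0; lia.
Qed.

(* 0, 1 and t form an equilateral triangle, with centre g = (1 + t) / 3. *)
Lemma legendre_sum_cubic : exists2 g, g != 0 &
  \sum_(x : F) (x * (x - 1) * (x - t)) ^+ n = g ^+ (3 * n) * \sum_(x : F) (x ^+ 3 + 1) ^+ n.
Proof.
have F3 := F3_neq0 F k cardF; pose g := (1 + t) / 3.
have gE : 3 * g = 1 + t by rewrite mulrC divfK.
have tg : t = 3 * g ^+ 2.
  apply: (mulfI F3); transitivity ((3 * g) ^+ 2); last by ring.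
  by rewrite gE sqrrD tE; ring.
have g0 : g != 0.
  apply/eqP => g0; move: gE tg; rewrite g0 expr0n !mulr0 => /eqP + t0.
  by rewrite t0 addr0 eq_sym oner_eq0.
clearbody g; exists g => //; rewrite (reindex_inj (mulfI g0)) (reindex_inj (addIr 1)) /= mulr_sumr.
apply: eq_bigr => x _; rewrite [g ^+ _]exprM -exprMn; congr (_ ^+ _).
transitivity (g * (x + 1) * ((g * (x + 1)) ^+ 2 - (1 + t) * (g * (x + 1)) + t)); first by ring.
by rewrite -gE {1}tg; ring.
Qed.

(** Squaring removes (-1)^n and the factor g^(3n), whose square is g^(3(q - 1)) = 1. *)
Lemma bin2_poly_hasse : (bin2_poly F n).[t] ^+ 2 = ((1 + 3 * chi_class F k 1) ^+ 2)%:~R.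
Proof.
have [g g0 E] := legendre_sum_cubic; rewrite rmorphXn /= chi_class_hasse -sum_cubic.
transitivity ((- (- 1) ^+ n * (bin2_poly F n).[t]) ^+ 2).
  by rewrite exprMn sqrrN sqrr_sign mul1r.
rewrite -legendre_sum E exprMn -exprM (_ : 3 * n * 2 = 6 * k * 3)%N; last by lia.
have := expf_pred_card F g g0; rewrite cardF /= => g1.
by rewrite (exprM g (6 * k) 3) g1 expr1n mul1r.
Qed.

End Hasse.

(** The prime p divides (xb - ay)(xb + ay). If it divides xb - ay, then p^2 = (xa + 3yb)^2 + 3(xb -
    ay)^2 forces xb = ay; the other factor is the same case with -a for a. *)
Lemma sqr_add3_uniq (p : nat) (x y a b : int) : prime p ->
  p%:Z = x ^+ 2 + 3 * y ^+ 2 -> p%:Z = a ^+ 2 + 3 * b ^+ 2 -> x ^+ 2 = a ^+ 2.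
Proof.
move=> p_pr.
have key (a' : int) : (p%:Z %| x * b - a' * y)%Z -> p%:Z = x ^+ 2 + 3 * y ^+ 2 ->
    p%:Z = a' ^+ 2 + 3 * b ^+ 2 -> x ^+ 2 = a' ^+ 2.
  move=> /dvdzP[c cE] px pa.
  have p0 : p%:Z != 0 by rewrite eqz_nat -lt0n prime_gt0.
  have E : p%:Z ^+ 2 = (x * a' + 3 * y * b) ^+ 2 + 3 * (x * b - a' * y) ^+ 2.
    by rewrite expr2 {1}px pa; ring.
  have c0 : c = 0.
    apply/eqP; apply: contraTT isT => c0; exfalso.
    have h : 3 * c ^+ 2 <= 1.
      rewrite -(ler_pM2r (_ : 0 < p%:Z ^+ 2)) ?exprn_gt0 ?ltz_nat ?prime_gt0 //.
      rewrite mul1r [X in _ <= X]E cE.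
      by rewrite -subr_ge0 (_ : _ - _ = (x * a' + 3 * y * b) ^+ 2) ?sqr_ge0 //; ring.
    have : 0 < c ^+ 2 by rewrite exprn_even_gt0.
    lia.
  move: cE; rewrite c0 mul0r => /eqP; rewrite subr_eq0 => /eqP xb.
  apply: (mulfI p0); rewrite {1}pa px.
  transitivity (x ^+ 2 * a' ^+ 2 + 3 * (x * b) ^+ 2); first by ring.
  by rewrite xb; ring.
move=> px pa.
have : (p%:Z %| (x * b - a * y) * (x * b + a * y))%Z.
  apply/dvdzP; exists (b ^+ 2 - y ^+ 2).
  transitivity ((b ^+ 2) * (x ^+ 2 + 3 * y ^+ 2) - y ^+ 2 * (a ^+ 2 + 3 * b ^+ 2)); first by ring.
  by rewrite -px -pa; ring.
rewrite dvdzE abszM Euclid_dvdM // -!dvdzE => /orP[]; first by move/key; apply.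
rewrite -[a * y]opprK -mulNr => /key -> //; rewrite ?sqrrN //.
Qed.

(** * Reduction modulo p of the rational sums *)

Section Reduction.
Context (p : nat) (K : fieldType) (p_pr : prime p) (chp : p \in [pchar K]).

(* r is p-integral and x is the image of its residue in K *)
Definition reduces (r : rat) (x : K) : Prop :=
  exists a b : int, [/\ b%:~R != 0 :> K, r = a%:~R / b%:~R & x = a%:~R / b%:~R].

Lemma intK_eq0 (a : int) : (a%:~R == 0 :> K) = (p%:Z %| a)%Z.
Proof.
rewrite dvdzE absz_nat; case: a => a; first by rewrite /= -pmulrn (dvdn_pcharf chp).
by rewrite NegzE rmorphN oppr_eq0 /= -pmulrn (dvdn_pcharf chp).
Qed.

Lemma int_neq0 (b : int) : b%:~R != 0 :> K -> b%:~R != 0 :> rat.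
Proof. by apply: contraNN; rewrite intr_eq0 => /eqP ->. Qed.

Lemma reduces_int (a : int) : reduces a%:~R a%:~R.
Proof. by exists a, 1; rewrite !divr1 oner_neq0. Qed.

Lemma reduces_nat (a : nat) : reduces a%:R a%:R.
Proof. exact: (reduces_int a). Qed.

Lemma reducesD r s x y : reduces r x -> reduces s y -> reduces (r + s) (x + y).
Proof.
move=> [a [b [b0 -> ->]]] [c [d [d0 -> ->]]]; exists (a * d + c * b), (b * d).
by rewrite !rmorphM !rmorphD !rmorphM /= mulf_neq0 // !addf_div ?int_neq0.
Qed.

Lemma reducesM r s x y : reduces r x -> reduces s y -> reduces (r * s) (x * y).
Proof.
move=> [a [b [b0 -> ->]]] [c [d [d0 -> ->]]]; exists (a * c), (b * d).
by rewrite !rmorphM /= mulf_neq0 // !mulf_div.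
Qed.

Lemma reducesN r x : reduces r x -> reduces (- r) (- x).
Proof.
by move=> [a [b [b0 -> ->]]]; exists (- a), b; rewrite !rmorphN /= !mulNr.
Qed.

Lemma reducesV r x : x != 0 -> reduces r x -> reduces r^-1 x^-1.
Proof.
move=> x0 [a [b [b0 -> E]]]; exists b, a; rewrite E !invf_div; split=> //.
by apply: contraNneq x0 => a0; rewrite E a0 mul0r.
Qed.

Lemma reduces0 : reduces 0 0. Proof. exact: (reduces_nat 0). Qed.
Lemma reduces1 : reduces 1 1. Proof. exact: (reduces_nat 1). Qed.

Lemma reducesX r x i : reduces r x -> reduces (r ^+ i) (x ^+ i).
Proof.
move=> h; elim: i => [|i IH]; first exact: reduces1.
by rewrite !exprS; apply: reducesM.
Qed.

Lemma reduces_sum (a b : nat) (u : nat -> rat) (v : nat -> K) :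
  (forall i, (a <= i < b)%N -> reduces (u i) (v i)) ->
  reduces (\sum_(a <= i < b) u i) (\sum_(a <= i < b) v i).
Proof.
move=> h; rewrite [X in reduces X _]big_nat [X in reduces _ X]big_nat.
elim/big_ind2: _ => //; [exact: reduces0 | by move=> *; apply: reducesD].
Qed.

Lemma reduces_eqmod r s x : reduces r x -> reduces s x -> eqmod_rat p r s.
Proof.
move=> hr /reducesN /(reducesD _ _ _ _ hr) [a [b [b0 E]]].
rewrite subrr => /esym/eqP; rewrite mulf_eq0 invr_eq0 (negPf b0) orbF intK_eq0.
move=> /dvdzP[c ca]; exists (c%:~R / b%:~R); last by rewrite E ca rmorphM /= mulrAC mulrC mulrA.
have b0' := int_neq0 b b0.
rewrite inE /=; set u := _ / _; have uE : numq u * b = c * denq u.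
  apply: (@intr_inj rat); rewrite !rmorphM /= numqE mulrAC.
  by rewrite /u divfK.
have : (denq u %| b)%Z.
  rewrite -(@Gauss_dvdzr _ (numq u)) ?uE ?dvdz_mull //.
  by rewrite coprimez_sym /coprimez /gcdz; have := coprime_num_den u; rewrite /coprime => /eqP ->.
rewrite /coprimez /gcdz absz_nat eqz_nat -/(coprime _ _) prime_coprime // => db.
apply: contra b0 => pd; rewrite intK_eq0; apply: dvdz_trans db.
by rewrite dvdzE absz_nat.
Qed.

Lemma reduces_harm i : (i < p)%N -> reduces (harmonic_number i) (harm K i).
Proof.
move=> ip; apply: reduces_sum => j /andP[j0 ji]; apply: reducesV (reduces_nat _).
by rewrite -(dvdn_pcharf chp) gtnNdvd // (leq_trans _ ip).
Qed.

Definition integral (r : rat) : Prop := exists x, reduces r x.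

(** Below 2p the only denominator divisible by p is p itself, so one factor p suffices. *)
Lemma integral_p_harm i : (i < p.*2)%N -> integral (p%:R * harmonic_number i).
Proof.
move=> ip; rewrite /harmonic_number mulr_sumr big_nat.
elim/big_ind: _ => [|r s [x rx] [y sy]|j /andP[j0 ji]].
- by exists 0; apply: reduces0.
- by exists (x + y); apply: reducesD.
have [->|jp] := eqVneq j p.
  by exists 1; rewrite divff ?pnatr_eq0 -?lt0n ?prime_gt0 //; apply: reduces1.
exists (p%:R * j%:R^-1); apply: reducesM (reduces_nat _) (reducesV _ _ _ (reduces_nat _)).
rewrite -(dvdn_pcharf chp); apply/negP => /dvdnP[c jE].
move: j0 ji ip jp; rewrite jE -mul2n => j0 ji ip.
case: c j0 ji {jE} => [|[|c]]; rewrite ?mul0n ?mul1n ?eqxx //.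
move=> _ ci; have : (2 * p <= c.+2 * p)%N by rewrite leq_mul2r orbT.
lia.
Qed.

End Reduction.

Section LegendreN1.
Context (n : nat) (n_gt0 : (0 < n)%N) (p_pr : prime n.*2.+1).
Local Notation p := n.*2.+1.

Lemma expN1_half_cases : (- 1) ^+ n = 1 :> 'F_p -> ~~ odd n.
Proof.
rewrite -signr_odd; case: (odd n) => //= /eqP; rewrite expr1 eq_sym -addr_eq0 => /eqP E.
have := dvdn_pcharf (pchar_Fp p_pr) 2; rewrite [2%:R](_ : _ = 1 + 1) // E eqxx => h.
by have := dvdn_leq (isT : 0 < 2)%N h; move: n_gt0; lia.
Qed.

(** If z^2 = -1, then (-1)^n = z^(p - 1) = 1. For n even, any y with y^n = -1 yields the square root
    y^(n/2) of -1. *)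
Lemma legendre_N1 : legendre (-1) p = (- 1) ^+ n.
Proof.
have nat_Fp (x : 'F_p) : (nat_of_ord x)%:R = x by apply: natr_Zp.
have intE (a : int) := intK_eq0 p 'F_p (pchar_Fp p_pr) a.
have N1 : (p%:Z %| -1)%Z = false.
  by rewrite -intE rmorphN1 oppr_eq0 oner_eq0.
have sqE (x : nat) : ((x%:Z ^+ 2 == -1 %[mod p%:Z])%Z) = (x%:R ^+ 2 == -1 :> 'F_p).
  by rewrite eqz_mod_dvd opprK -intE rmorphD rmorphXn rmorph1 /= addr_eq0.
have cardF : #|'F_p| = p := card_Fp p_pr.
rewrite /legendre N1; case: existsP => [[x]|nex].
  rewrite sqE => /eqP zE; set z : 'F_p := _%:R in zE.
  have z0 : z != 0 by rewrite -sqrf_eq0 zE oppr_eq0 oner_eq0.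
  have : (- 1) ^+ n = 1 :> 'F_p.
    by rewrite -zE -exprM mul2n; have := expf_pred_card _ z z0; rewrite cardF.
  by move/expN1_half_cases => n_even; rewrite -signr_odd (negPf n_even).
rewrite -signr_odd; case n_odd: (odd n) => //; case: nex.
have [|y y0 yn] := exists_expf_neq1 'F_p n.
  by rewrite n_gt0 cardF /=; move: n_gt0; lia.
have yN1 : y ^+ n = -1.
  have : (y ^+ n - 1) * (y ^+ n + 1) = 0.
    have E : (y ^+ n) ^+ 2 = 1.
      by rewrite -exprM muln2; have := expf_pred_card _ y y0; rewrite cardF.
    by transitivity ((y ^+ n) ^+ 2 - 1); [ring | rewrite E subrr].
  by move/eqP; rewrite mulf_eq0 subr_eq0 (negPf yn) addr_eq0 => /eqP.
pose z := y ^+ n./2.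
have zp : (z < p)%N by rewrite -[X in (_ < X)%N](Fp_cast p_pr).
have nE : (n./2 * 2 = n)%N by rewrite muln2 -[RHS]odd_double_half n_odd.
by exists (Ordinal zp); rewrite sqE /= nat_Fp /z -exprM nE yN1.
Qed.

End LegendreN1.

(** * The harmonic sums and the Fermat quotient modulo p *)

Section HarmonicSum.
Context (n : nat) (K : fieldType) (n_gt0 : (0 < n)%N).
Local Notation p := n.*2.+1.
Context (p_pr : prime p) (chp : p \in [pchar K]).
Local Notation FP := (bin3_poly K n).
Local Notation GP := (bin3h_poly K n).
Local Notation H := (harm K n).
Local Notation hdiff := (harm_gap K).
Local Notation binK := (binF K n).
Local Notation reduces := (reduces K).

Let K2 : 2 != 0 :> K. Proof. exact: two_neq0 K n chp n_gt0. Qed.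

Lemma central_binS k : (k.+1 * 'C(2 * k.+1, k.+1) = 2 * ((2 * k).+1 * 'C(2 * k, k)))%N.
Proof.
have E : 'C((2 * k).+1, k) = 'C((2 * k).+1, k.+1).
  by rewrite -[RHS]bin_sub; [congr 'C(_, _); lia | lia].
rewrite (_ : 2 * k.+1 = (2 * k).+2)%N; last by lia.
by rewrite binS E addnn -mul2n mulnCA -mul_bin_diag.
Qed.

Lemma central_binF k : (k <= n)%N -> 'C(2 * k, k)%:R = binK k * (- 4) ^+ k.
Proof.
elim: k => [|k IH] k_le; first by rewrite /binF !bin0 mulr1.
have k1 : k.+1%:R != 0 :> K.
  by rewrite -(dvdn_pcharf chp) gtnNdvd // ltnS (leq_trans k_le) // -addnn leq_addr.
apply: (mulfI k1); rewrite -natrM central_binS !natrM IH 1?ltnW //.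
have := binFS K n chp k; rewrite exprS -[k.+1%:R]natr1 -[(2 * k).+1%:R]natr1 natrM => E.
transitivity (- 2 * (- (2 * k%:R + 1) * binK k) * (- 4) ^+ k); first by ring.
by rewrite -E; ring.
Qed.

Lemma pF_fact_neq0 k : (k < p)%N -> k`!%:R != 0 :> K.
Proof.
elim: k => [|k IH] kp; first by rewrite fact0 oner_neq0.
rewrite factS natrM mulf_neq0 ?IH 1?ltnW //.
by rewrite -(dvdn_pcharf chp) gtnNdvd.
Qed.

Lemma dvdn_central_bin k : (n < k < p)%N -> (p %| 'C(2 * k, k))%N.
Proof.
move=> /andP[nk kp]; rewrite (dvdn_pcharf chp).
have : ('C(2 * k, k) * (k`! * k`!))%:R == 0 :> K.
  have kk : (2 * k - k = k)%N by lia.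
  have := @bin_fact (2 * k) k; rewrite kk => -> //; last by lia.
  by rewrite -(dvdn_pcharf chp) dvdn_fact //; lia.
by rewrite !natrM !mulf_eq0 (negPf (pF_fact_neq0 k kp)) !orbF.
Qed.

Definition harmonic_sumK (z : K) : K :=
  \sum_(k < n.+1) k%:R * binK k ^+ 3 * z ^+ k * hdiff k.

(** For k <= n the cube of (-4)^k is (-64)^k, hence the argument -64/m. For k > n the cube of
    C(2k,k) contains p^3, against a single p in the denominators of the harmonic numbers. *)
Lemma reduces_harmonic_sum (m : nat) : m%:R != 0 :> K ->
  reduces (harmonic_binomial_sum p m) (harmonic_sumK (- 64 / m%:R)).
Proof.
move=> m0; rewrite /harmonic_binomial_sum (@big_cat_nat _ _ _ n.+1) //=; last first.
  by rewrite ltnS -addnn leq_addr.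
rewrite -[harmonic_sumK _]addr0; apply: reducesD.
  rewrite /harmonic_sumK.
  rewrite -(big_mkord predT (fun k => k%:R * binK k ^+ 3 * (- 64 / m%:R) ^+ k * hdiff k)).
  apply: reduces_sum => k /andP[_]; rewrite ltnS => kn.
  have -> : k%:R * binK k ^+ 3 * (- 64 / m%:R) ^+ k * hdiff k =
     k%:R * 'C(2 * k, k)%:R ^+ 3 * (m%:R ^+ k)^-1 * hdiff k.
    have E64 : (- 64) ^+ k = ((- 4) ^+ k) ^+ 3 :> K.
      by rewrite -exprM mulnC exprM; congr (_ ^+ k); ring.
    by rewrite central_binF // !exprMn exprVn E64; ring.
  apply: reducesM; last first.
    have kp : (k.*2 < p)%N by rewrite ltnS leq_double.
    apply: reducesD; last apply: reducesN; rewrite ?mul2n; apply: (reduces_harm p K chp) => //.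
    by rewrite (leq_ltn_trans _ kp) // -addnn leq_addr.
  apply: reducesM; last by apply: reducesV; [rewrite expf_neq0 | apply/reducesX/reduces_nat].
  by apply: reducesM; [|apply: reducesX]; apply: reduces_nat.
have -> : 0 = \sum_(n.+1 <= k < p) (0 : K) by rewrite big1.
apply: reduces_sum => k /andP[nk kp].
have [c cE] := dvdnP (dvdn_central_bin k (introT andP (conj nk kp))).
have [x hx] : integral K (p%:R * harmonic_number (2 * k)).
  by apply: integral_p_harm => //; rewrite mul2n ltn_double.
have [y hy] : integral K (p%:R * harmonic_number k).
  by apply: integral_p_harm => //; move: kp; lia.
have -> : k%:R * 'C(2 * k, k)%:R ^+ 3 / m%:R ^+ k * (harmonic_number (2 * k) - harmonic_number k) =
  (p%:R : rat) * (p%:R * k%:R * c%:R ^+ 3 * (m%:R ^+ k)^-1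
    * (p%:R * harmonic_number (2 * k) - p%:R * harmonic_number k)).
  by rewrite cE natrM; ring.
have -> : (0 : K) = p%:R * (p%:R * k%:R * c%:R ^+ 3 * (m%:R ^+ k)^-1 * (x - y)).
  by rewrite (pcharf0 chp) mul0r.
have hn := reduces_nat K; have mk : m%:R ^+ k != 0 :> K by rewrite expf_neq0.
apply: reducesM (hn _) _; apply: reducesM; last exact: reducesD hx (reducesN _ _ _ hy).
apply: reducesM; last exact: reducesV mk (reducesX _ _ _ _ (hn _)).
by apply: reducesM (reducesX _ _ _ _ (hn _)); apply: reducesM.
Qed.

Lemma horner1_deriv (c : nat -> K) :
  (\poly_(k < n.+1) c k)^`().[1] = \sum_(k < n.+1) k%:R * c k.
Proof.
rewrite -[LHS]mul1r -[X in X * _](hornerX 1) -hornerM -/(theta _).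
have -> : theta (\poly_(k < n.+1) c k) = \poly_(k < n.+1) (k%:R * c k).
  by apply/polyP => k; rewrite coef_theta !coef_poly; case: ifP => //; rewrite mulr0.
by rewrite horner_poly; apply: eq_bigr => k _; rewrite expr1n mulr1.
Qed.

Lemma harmonic_sumK_N4 : harmonic_sumK (- 4) = GP^`().[1].
Proof. by rewrite /bin3h_poly horner1_deriv; apply: eq_bigr => k _; rewrite !mulrA. Qed.

Lemma expr4_half : 4 ^+ n = 1 :> K.
Proof.
have := pFrobenius_aut_nat chp 2; rewrite pFrobenius_autE exprS => E.
have : 2 ^+ n.*2 = 1 :> K by apply: (mulfI K2); rewrite mulr1.
by rewrite -mul2n exprM; congr (_ ^+ n = 1); ring.
Qed.

(** Under k -> n - k, with 4^n = 1 and 2n = -1, the factor 2k h_k turns into (2k + 1)(h_k + H);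
    expanding this gives the four sums. *)
Lemma harmonic_sumK_N4V : 2 * harmonic_sumK (- 4)^-1 =
  (- 1) ^+ n * (2 * GP^`().[1] + GP.[1] + 2 * H * FP^`().[1] + H * FP.[1]).
Proof.
have N4 : - 4 != 0 :> K by rewrite oppr_eq0 (natf4_neq0 K p) // p_gt2.
rewrite /bin3h_poly /bin3_poly !horner1_deriv !horner_poly /harmonic_sumK.
rewrite (sum_rev K n (fun k => k%:R * binK k ^+ 3 * (- 4)^-1 ^+ k * hdiff k)).
rewrite [2 * \sum_(_ < _) (_ * (_ * _ * _))]mulr_sumr [2 * H * _]mulr_sumr [H * _]mulr_sumr.
rewrite [2 * _]mulr_sumr -!big_split [RHS]mulr_sumr /=; apply: eq_bigr => -[k /= k_le] _.
rewrite ltnS in k_le; rewrite binF_rev // harm_gap_rev // natrB //.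
have -> : (- 4)^-1 ^+ (n - k) = (- 1) ^+ n * (- 4) ^+ k :> K.
  apply: (mulfI (expf_neq0 n N4)); rewrite -{1}(subnK k_le) exprD mulrAC exprVn mulfV ?expf_neq0 //.
  rewrite mul1r mulrA -[- 4]mulN1r 2!exprMn mulrAC -[_ * (-1) ^+ n]mulrC.
  rewrite expr4_half; transitivity (((- 1) ^+ n) ^+ 2 * ((- 1) ^+ k * 4 ^+ k) : K); last by ring.
  by rewrite sqrr_sign mul1r.
have N2 : 2 * (n%:R - k%:R) = - (1 + 2 * k%:R) :> K.
  by transitivity (n%:R *+ 2 - 2 * k%:R : K); [ring | rewrite half_pchar //; ring].
rewrite !expr1n !mulr1 -!mulrA mulrA N2; ring.
Qed.

(** C(p,j)/p = C(p-1,j-1)/j is (-1)^(j-1)/j modulo p, so (2^p - 2)/p becomes an alternating harmonic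
    sum, which is h_n = - H_n. *)
Lemma reduces_fermat_quotient2 : reduces (fermat_quotient2 p) (- H / 2).
Proof.
pose c j := ('C(p, j) %/ p)%N.
have cE j : (0 < j < p)%N -> 'C(p, j) = (p * c j)%N.
  by move=> jp; rewrite /c mulnC divnK // prime_dvd_bin.
have sumC : (2 ^ p = 2 + p * \sum_(1 <= j < p) c j)%N.
  rewrite -[2%N]/(1 + 1)%N [LHS]expnDn.
  rewrite -(big_mkord predT (fun i => 'C(p, i) * (1 ^ (p - i) * 1 ^ i))%N).
  rewrite big_nat_recr // big_ltn //= bin0 binn !exp1n !mul1n addnC addnA; congr addn.
  rewrite big_distrr /=; apply: eq_big_nat => j jp.
  by rewrite !exp1n !muln1 cE.
have p0 : p%:R != 0 :> rat by rewrite pnatr_eq0.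
have -> : fermat_quotient2 p = (\sum_(1 <= j < p) c j)%:R / 2.
  apply: (mulIf p0); apply: (@mulIf rat 2) => //.
  rewrite /fermat_quotient2 divfK // mulrAC divfK //= mulrBl mul1r -exprSr.
  by rewrite -natrX sumC natrD natrM; ring.
have -> : - H = (\sum_(1 <= j < p) c j)%:R :> K.
  have bin_pred j : (j < p)%N -> 'C(p.-1, j)%:R = (- 1) ^+ j :> K.
    elim: j => [|j IH] jp; first by rewrite bin0.
    have := bin_lt_pcharf_0 chp (k := j.+1); rewrite jp binS natrD.
    rewrite IH ?(ltnW jp) // => /(_ isT) /eqP.
    by rewrite addr_eq0 exprS mulN1r => /eqP.
  have -> : - H = hdiff n by rewrite /harm_gap harm_pchar // sub0r.
  rewrite natr_sum.
  transitivity (\sum_(1 <= j < p) (- 1) ^+ j.-1 / j%:R : K); last first.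
    apply: eq_big_nat => -[|j] // /andP[_ jp].
    have j0 : j.+1%:R != 0 :> K by rewrite -(dvdn_pcharf chp) gtnNdvd.
    apply: (mulfI j0); rewrite mulrC divfK // -bin_pred 1?ltnW //.
    have := mul_bin_diag p j; rewrite cE //= mulnCA => /eqP.
    by rewrite eqn_pmul2l // -natrM => /eqP ->.
  have alt : forall i, hdiff i = \sum_(1 <= j < i.*2.+1) (- 1) ^+ j.-1 / j%:R.
    elim=> [|i IH]; first by rewrite /harm_gap /harm !big_geq // subrr.
    rewrite (harm_gapS K n) // IH doubleS !(big_nat_recr _.+1) //=.
    have e : (- 1) ^+ i.*2 = 1 :> K by rewrite -signr_odd odd_double.
    rewrite exprS e mulr1 mul1r mulN1r.
    congr (_ + _^-1 - _^-1); first by rewrite -[i.*2.+1]addn1 natrD -mul2n natrM.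
    by rewrite -[i.*2.+2]addn2 natrD -mul2n natrM.
  exact: alt.
by apply: reducesM; [|apply: reducesV => //]; apply: reduces_nat.
Qed.

End HarmonicSum.

(** The root is -w for a cube root of unity w != 1, obtained as a (q - 1)/3-th power. *)
Lemma exists_sixth_root (F : finFieldType) :
  (3 %| #|F|.-1)%N -> exists t : F, t ^+ 2 = t - 1.
Proof.
move=> /dvdnP[j jE]; have F1 := card_gt1 F.
have [|y y0 yj] := exists_expf_neq1 F j; first by move: jE F1; lia.
exists (- y ^+ j); set w := y ^+ j in yj *.
have : (w - 1) * (w ^+ 2 + w + 1) = 0.
  have E : w ^+ 3 = 1 by rewrite -exprM -jE expf_pred_card.
  by transitivity (w ^+ 3 - 1); [ring | rewrite E subrr].
move/eqP; rewrite mulf_eq0 subr_eq0 (negPf yj) /= => /eqP E.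
by transitivity (w ^+ 2 + w + 1 - w - 1); [ring | rewrite E; ring].
Qed.

(** As 3 divides p^2 - 1, the field with p^2 elements serves both residue classes of p modulo 3. *)
Lemma exists_field_sixth_root (p : nat) : prime p -> (3 < p)%N ->
  exists2 K : finFieldType, p \in [pchar K] & exists t : K, t ^+ 2 = t - 1.
Proof.
move=> p_pr p_gt3; have [K chK cK] := @pPrimePowerField p 2 p_pr isT.
exists K => //; apply: exists_sixth_root; rewrite cK.
have : ~~ (3 %| p)%N by rewrite dvdn_prime2 // neq_ltn p_gt3.
have -> : (p ^ 2).-1 = ((p - 1) * (p + 1))%N.
  by rewrite -subn1 -[1%N in LHS](exp1n 2) subn_sqr.
move=> np; rewrite Euclid_dvdM //; lia.
Qed.

(** * Values of the two sums in characteristic p *)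

Section Values.
Context (n : nat) (K : fieldType) (n_gt1 : (1 < n)%N).
Context (p_pr : prime n.*2.+1) (chp : n.*2.+1 \in [pchar K]).
Context (t : K) (tE : t ^+ 2 = t - 1).
Local Notation S0 := (bin3_poly K n).[1].
Let n_gt0 : (0 < n)%N := ltnW n_gt1.

Lemma six_neq0 : 6 != 0 :> K.
Proof.
have -> : 6 = 2 * 3 :> K by rewrite -natrM.
by rewrite mulf_neq0 ?(three_neq0 K n) ?(two_neq0 K n).
Qed.

Lemma harmonic_sumK_val :
  18 * harmonic_sumK n K (- 4) = 3 - 3 * S0 + 2 * harm K n * S0.
Proof. by rewrite harmonic_sumK_N4; apply: (deriv_bin3h_poly_1_val K n chp n_gt1 t tE). Qed.

(** The extra terms G(1) + 2 H F'(1) + H F(1) cancel, because 3 G(1) = - H F(1) and 3 F'(1) = -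
    F(1). *)
Lemma harmonic_sumK_rev : harmonic_sumK n K (- 4)^-1 = (- 1) ^+ n * harmonic_sumK n K (- 4).
Proof.
apply: (mulfI six_neq0); rewrite harmonic_sumK_N4.
transitivity (3 * (2 * harmonic_sumK n K (- 4)^-1)); first by ring.
rewrite harmonic_sumK_N4V //.
transitivity ((- 1) ^+ n * (6 * (bin3h_poly K n)^`().[1] + 3 * (bin3h_poly K n).[1]
  + 2 * harm K n * (3 * (bin3_poly K n)^`().[1]) + 3 * harm K n * S0)); first by ring.
by rewrite (bin3h_poly_1_val K n chp n_gt1 t tE) (deriv_bin3_poly_1_val K n chp n_gt1 t tE); ring.
Qed.

Lemma reduces_sum16 :
  reduces K (harmonic_binomial_sum n.*2.+1 16 - 1 / 6) (harmonic_sumK n K (- 4) - 1 / 6).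
Proof.
have K2 := two_neq0 K n chp n_gt0.
have K16 : 16 != 0 :> K by rewrite (_ : 16 = 2 ^+ 4) ?expf_neq0 // -natrX.
apply: reducesD; last apply: reducesN.
  have -> : - 4 = - 64 / 16%:R :> K by apply: (mulIf K16); rewrite divfK //; ring.
  exact: reduces_harmonic_sum.
apply: reducesM (reduces1 K) _; apply: reducesV six_neq0 (reduces_nat K 6).
Qed.

Lemma reduces_sum256 :
  reduces K ((legendre (-1) n.*2.+1)%:~R * harmonic_binomial_sum n.*2.+1 256 - 1 / 6)
    (harmonic_sumK n K (- 4) - 1 / 6).
Proof.
have K2 := two_neq0 K n chp n_gt0.
have K4 : - 4 != 0 :> K.
  by rewrite oppr_eq0 (_ : 4 = 2 ^+ 2) ?expf_neq0 // -natrX.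
have K256 : 256 != 0 :> K by rewrite (_ : 256 = 2 ^+ 8) ?expf_neq0 // -natrX.
apply: reducesD; last apply: reducesN.
  have -> : harmonic_sumK n K (- 4) = (- 1) ^+ n * harmonic_sumK n K (- 64 / 256%:R).
    have -> : - 64 / 256%:R = (- 4)^-1 :> K.
      by apply: (mulIf K256); apply: (mulIf K4); rewrite divfK // mulrAC mulVf //; ring.
    by rewrite harmonic_sumK_rev mulrA -expr2 sqrr_sign mul1r.
  apply: reducesM; last exact: reduces_harmonic_sum.
  have -> : (- 1) ^+ n = ((- 1) ^+ n)%:~R :> K by rewrite rmorphXn /= rmorphN1.
  by rewrite legendre_N1 //; apply: reduces_int.
apply: reducesM (reduces1 K) _; apply: reducesV six_neq0 (reduces_nat K 6).
Qed.

End Values.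

(** * Primes of the form x^2 + 3y^2 and the final congruences *)

Lemma sqr_add3_mod6 (p : nat) (x y : int) : prime p -> (3 < p)%N ->
  p%:Z = x ^+ 2 + 3 * y ^+ 2 -> exists2 k, (0 < k)%N & p = (6 * k).+1.
Proof.
move=> p_pr p_gt3 px.
have p3 : ~~ (3 %| p)%N by rewrite dvdn_prime2 // neq_ltn p_gt3.
have p2 : ~~ (2 %| p)%N by rewrite dvdn_prime2 // neq_ltn (ltn_trans _ p_gt3).
have : exists u, x = 3 * u \/ x = 3 * u + 1 \/ x = 3 * u + 2.
  by exists (x %/ 3)%Z; lia.
move: px; set y2 := y ^+ 2 => px [u xu].
have : exists v, x ^+ 2 = 3 * v \/ x ^+ 2 = 3 * v + 1.
  case: xu => [->|[->|->]].
  - by exists (3 * u ^+ 2); left; ring.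
  - by exists (3 * u ^+ 2 + 2 * u); right; ring.
  - by exists (3 * u ^+ 2 + 4 * u + 1); right; ring.
move=> [v xv]; exists (p %/ 6)%N; move: xv px; move: (x ^+ 2) => x2; lia.
Qed.

(** The norm of the Jacobi sum gives 4p = a^2 + 3 (2b)^2 for a = 1 + 3 [chi_class 1]. Then a is
    even, p = (a/2)^2 + 3 b^2, and uniqueness gives (a/2)^2 = x^2. *)
Lemma bin2_poly_sqr_add3 (F : finFieldType) (k : nat) (x y : int) (t : F) :
  (0 < k)%N -> #|F| = (6 * k).+1 -> prime (6 * k).+1 ->
  (6 * k).+1%:Z = x ^+ 2 + 3 * y ^+ 2 -> t ^+ 2 = t - 1 ->
  (bin2_poly F (3 * k)).[t] ^+ 2 = 4 * x%:~R ^+ 2.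
Proof.
move=> k_gt0 cardF p_pr px tE.
have wE : (- t) ^+ 2 = - - t - 1 by rewrite sqrrN tE opprK.
rewrite (bin2_poly_hasse F k k_gt0 cardF t tE).
have [W WE] : exists W : algC, W ^+ 2 = - W - 1.
  have [W] := @solve_monicpoly algC 2 (fun=> -1) isT.
  by rewrite big_ord_recl big_ord1 /= mulr1 expr1 mulN1r => WE; exists W; rewrite WE addrC.
have norm := chi_class_norm F k k_gt0 cardF (- t) wE algC W WE.
have [b bE] := chi_class_even F k k_gt0 cardF (- t) wE.
move: norm; rewrite bE cardF; set a := 1 + _ => aE.
have [c cE] : exists c, a = 2 * c.
  have : exists c, a = 2 * c \/ a = 2 * c + 1 by exists (a %/ 2)%Z; lia.
  move=> [c [ac|ac]]; first by exists c.
  (* An odd a would make 4p congruent to 1 modulo 4. *)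
  exfalso; move: aE; rewrite ac.
  have -> : (2 * c + 1) ^+ 2 = 4 * (c ^+ 2 + c) + 1 by ring.
  have -> : (2 * b) ^+ 2 = 4 * b ^+ 2 by ring.
  lia.
have pc : (6 * k).+1%:Z = c ^+ 2 + 3 * b ^+ 2.
  apply: (@mulfI _ 4) => //; rewrite -[_%:Z]natz -aE cE; ring.
rewrite cE -[x%:~R ^+ 2]rmorphXn /= (sqr_add3_uniq _ _ _ _ _ p_pr px pc).
by rewrite !rmorphXn rmorphM /=; ring.
Qed.

Theorem corollary4p2 (p : nat) (p_prime : prime p) (p_gt3 : (3 < p)%N) :
  let A : rat := harmonic_binomial_sum p 16 - 1 / 6 in
  let B : rat := (legendre (-1) p)%:~R * harmonic_binomial_sum p 256 - 1 / 6 in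
  [/\ eqmod_rat p A B,
      forall x y : int, p%:Z = x ^+ 2 + 3 * y ^+ 2 ->
        eqmod_rat p B (- 2 * x%:~R ^+ 2 * (4 * fermat_quotient2 p + 3) / 9)
    & (p = 2 %[mod 3])%N -> eqmod_rat p B 0].
Proof.
move=> A B.
have pE : p = p./2.*2.+1.
  rewrite -[LHS]odd_double_half; case: (even_prime p_prime) p_gt3 => [->|->] //.
have n_gt1 : (1 < p./2)%N by move: p_gt3; rewrite {1}pE; lia.
have n_gt0 := ltnW n_gt1.
rewrite {}/A {}/B; move: (p./2) pE n_gt0 n_gt1 => n pE; subst p => n_gt0 n_gt1.
split.
- have [K chp [t tE]] := exists_field_sixth_root _ p_prime p_gt3.
  apply: (reduces_eqmod _ K p_prime chp); first exact: (reduces_sum16 _ _ n_gt1 p_prime chp).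
  exact: (reduces_sum256 _ _ n_gt1 p_prime chp t tE).
- move=> x y pxy; have [k k_gt0 pk] := sqr_add3_mod6 _ _ _ p_prime p_gt3 pxy.
  have nk : n = (3 * k)%N by lia.
  have chp := pchar_Fp p_prime.
  (* As p = 1 modulo 3, t already lies in F_p, where the cardinality q = 6k + 1 is p itself. *)
  have [t tE] : exists t : 'F_n.*2.+1, t ^+ 2 = t - 1.
    by apply: exists_sixth_root; rewrite card_Fp // pk /=; lia.
  have bin3_poly_1 : (bin3_poly 'F_n.*2.+1 n).[1] = 4 * x%:~R ^+ 2.
    have := @bin2_poly_sqr_add3 'F_n.*2.+1 k x y t k_gt0; rewrite card_Fp // -pk -nk => h.
    by rewrite (bin3_poly_1 _ n chp n_gt1 t tE); apply: h.
  apply: (reduces_eqmod _ 'F_n.*2.+1 p_prime chp).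
    exact: (reduces_sum256 _ _ n_gt1 p_prime chp t tE).
  have K6 := six_neq0 n _ n_gt1 chp; have K3 := three_neq0 _ n chp n_gt1.
  have K2 := two_neq0 _ n chp n_gt0.
  have K9 : 9 != 0 :> 'F_n.*2.+1 by rewrite (_ : 9 = 3 ^+ 2) ?expf_neq0 // -natrX.
  have -> : harmonic_sumK n 'F_n.*2.+1 (- 4) - 1 / 6 =
      - 2 * x%:~R ^+ 2 * (4 * (- harm 'F_n.*2.+1 n / 2) + 3) / 9.
    apply: (mulIf K9); rewrite divfK //; apply: (mulIf K2).
    (* The summand 3 of [harmonic_sumK_val] cancels 18/6. *)
    transitivity (18 * harmonic_sumK n 'F_n.*2.+1 (- 4) - 3 * (6 * 6^-1)); first by ring.
    rewrite (harmonic_sumK_val n _ n_gt1 chp t tE) bin3_poly_1 divff //.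
    transitivity (- 4 * x%:~R ^+ 2 * (- 2 * harm 'F_n.*2.+1 n * (2 * 2^-1) + 3) : 'F_n.*2.+1).
      rewrite divff //; ring.
    ring.
  have hn := reduces_nat 'F_n.*2.+1.
  apply: reducesM; last exact: reducesV K9 (hn 9).
  apply: reducesM; first apply: reducesM.
  - exact: reducesN (hn 2).
  - exact: reducesX (reduces_int _ x).
  - by apply: reducesD (hn 3); apply: reducesM (hn 4) _; apply: reduces_fermat_quotient2.
- have [K chp [t tE]] := exists_field_sixth_root _ p_prime p_gt3.
  move=> p2; apply: (reduces_eqmod _ K p_prime chp).
    exact: (reduces_sum256 _ _ n_gt1 p_prime chp t tE).
  have K6 := six_neq0 n _ n_gt1 chp; have K3 := three_neq0 _ n chp n_gt1.
  rewrite (_ : _ - _ = 0); first exact: reduces0.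
  apply: (mulfI (mulf_neq0 K3 K6)); rewrite mulr0.
  transitivity (18 * harmonic_sumK n K (- 4) - 3 * (6 * 6^-1)); first by ring.
  rewrite (harmonic_sumK_val n _ n_gt1 chp t tE) (bin3_poly_1_eq0 K n chp n_gt1 t tE) // divff //.
  ring.
Qed.
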